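(* Let $P$ be a prime ideal of $\mathfrak{A}$ such that $\bigcap_{f\in P}\Pi(f)\neq\emptyset$. (i) If $\bigcap_{f\in P}Z(f)\neq\emptyset$, then there exists $a\in\mathbb{C}$ such that $P=\{f\in\mathfrak{A}: f(a)=0\}$. (ii) If $\bigcap_{f\in P}Z(f)=\emptyset$, then there exist $n\in\mathbb{Z}$ and a prime integer $p$ such that $P=\{f\in\mathfrak{A}: f(n)\equiv 0 \pmod p\}$.
   Context: $\mathfrak{A}$ denotes the ring (an integral domain) of integer-valued entire functions, i.e. the entire functions $f:\mathbb{C}\to\mathbb{C}$ with $f(\mathbb{Z})\subset\mathbb{Z}$, under pointwise operations. For $f\in\mathfrak{A}$, $\Pi(f)$ is the set of irreducible elements of $\mathfrak{A}$ dividing $f$ in $\mathfrak{A}$, and $Z(f)$ is the set of zeros of $f$ in $\mathbb{C}$, each zero occurring a number of times equal to its multiplicity.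
   Formalization: The prime ideal P is assumed nonzero: for P = {0}, with Π(0) all irreducibles and Z(0) = C, part (i) fails, since (z−a)sin(πz) is a nonzero element of the ring vanishing at a. *)

(* Defs.v *)
From Stdlib Require Import Reals ZArith Znumtheory.
From Stdlib Require Import FunctionalExtensionality ProofIrrelevance.
From Coquelicot Require Export Coquelicot.

Definition ZtoC (n : Z) : C := RtoC (IZR n).

(* [ex_derive] over the scalar ring [C] is complex differentiability. *)
Definition entire (f : C -> C) : Prop :=
  forall z : C, @ex_derive C_AbsRing C_NormedModule f z.

Record IVE : Type := mkIVE {
  IVE_fun :> C -> C;
  IVE_entire : entire IVE_fun;
  IVE_int : forall n : Z, exists m : Z, IVE_fun (ZtoC n) = ZtoC m
}.

Lemma IVE_ext (f g : IVE) : (forall z, f z = g z) -> f = g.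
Proof.
  destruct f as [f ef nf], g as [g eg ng]; simpl; intros H.
  apply functional_extensionality in H; subst g.
  f_equal; apply proof_irrelevance.
Qed.

Lemma entire_const (c : C) : entire (fun _ => c).
Proof. intros z; apply ex_derive_const. Qed.

Lemma entire_plus (f g : C -> C) :
  entire f -> entire g -> entire (fun z => (f z + g z)%C).
Proof.
  intros hf hg z; exact (@ex_derive_plus C_AbsRing C_NormedModule f g z (hf z) (hg z)).
Qed.

Lemma entire_opp (f : C -> C) : entire f -> entire (fun z => (- f z)%C).
Proof. intros hf z; exact (@ex_derive_opp C_AbsRing C_NormedModule f z (hf z)). Qed.

Lemma entire_mult (f g : C -> C) :
  entire f -> entire g -> entire (fun z => (f z * g z)%C).
Proof.
  intros hf hg z; destruct (hf z) as [df Hf], (hg z) as [dg Hg].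
  assert (H := @is_derive_mult C_AbsRing f g z df dg).
  exists (df * g z + f z * dg)%C.
  destruct Hf as [_ Hf], Hg as [_ Hg].
  destruct H as [_ H].
  - split; [apply is_linear_scal_l | exact Hf].
  - split; [apply is_linear_scal_l | exact Hg].
  - exact Cmult_comm.
  - split; [apply is_linear_scal_l | exact H].
Qed.

Definition IVE_zero : IVE.
Proof.
  refine (mkIVE (fun _ => RtoC 0) (entire_const _) _).
  intros n; now exists 0%Z.
Defined.

Definition IVE_one : IVE.
Proof.
  refine (mkIVE (fun _ => RtoC 1) (entire_const _) _).
  intros n; now exists 1%Z.
Defined.

Definition IVE_plus (f g : IVE) : IVE.
Proof.
  refine (mkIVE (fun z => f z + g z)%C
            (entire_plus f g (IVE_entire f) (IVE_entire g)) _).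
  intros n; destruct (IVE_int f n) as [a Ha], (IVE_int g n) as [b Hb].
  exists (a + b)%Z; rewrite Ha, Hb; unfold ZtoC; now rewrite plus_IZR, RtoC_plus.
Defined.

Definition IVE_opp (f : IVE) : IVE.
Proof.
  refine (mkIVE (fun z => - f z)%C (entire_opp f (IVE_entire f)) _).
  intros n; destruct (IVE_int f n) as [a Ha].
  exists (- a)%Z; rewrite Ha; unfold ZtoC; now rewrite opp_IZR, RtoC_opp.
Defined.

Definition IVE_mult (f g : IVE) : IVE.
Proof.
  refine (mkIVE (fun z => f z * g z)%C
            (entire_mult f g (IVE_entire f) (IVE_entire g)) _).
  intros n; destruct (IVE_int f n) as [a Ha], (IVE_int g n) as [b Hb].
  exists (a * b)%Z; rewrite Ha, Hb; unfold ZtoC; now rewrite mult_IZR, RtoC_mult.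
Defined.

Definition IVE_AbelianMonoid_mixin : AbelianMonoid.mixin_of IVE.
Proof.
  apply (AbelianMonoid.Mixin IVE IVE_plus IVE_zero);
    intros; apply IVE_ext; intros t; simpl; ring.
Defined.

Canonical IVE_AbelianMonoid := AbelianMonoid.Pack IVE IVE_AbelianMonoid_mixin IVE.

Definition IVE_AbelianGroup_mixin : AbelianGroup.mixin_of IVE_AbelianMonoid.
Proof.
  apply (AbelianGroup.Mixin IVE_AbelianMonoid IVE_opp).
  intros; apply IVE_ext; intros t; simpl; ring.
Defined.

Canonical IVE_AbelianGroup :=
  AbelianGroup.Pack IVE
    (AbelianGroup.Class IVE IVE_AbelianMonoid_mixin IVE_AbelianGroup_mixin) IVE.

Definition IVE_Ring_mixin : Ring.mixin_of IVE_AbelianGroup.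
Proof.
  apply (Ring.Mixin IVE_AbelianGroup IVE_mult IVE_one);
    intros; apply IVE_ext; intros t; simpl; ring.
Defined.

Canonical IVE_Ring :=
  Ring.Pack IVE
    (Ring.Class IVE (AbelianGroup.class IVE_AbelianGroup) IVE_Ring_mixin) IVE.

Lemma IVE_mult_comm (f g : IVE) : mult f g = mult g f.
Proof. apply IVE_ext; intros z; apply Cmult_comm. Qed.

Definition divides (g f : IVE) : Prop := exists h : IVE, f = mult g h.

Definition is_unit (f : IVE) : Prop := exists g : IVE, mult f g = one.

Definition irreducible (f : IVE) : Prop :=
  f <> zero /\ ~ is_unit f /\
  forall g h : IVE, f = mult g h -> is_unit g \/ is_unit h.

Definition ideal (I : IVE -> Prop) : Prop :=
  I zero /\
  (forall f g : IVE, I f -> I g -> I (plus f g)) /\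
  (forall f g : IVE, I g -> I (mult f g)).

Definition prime_ideal (P : IVE -> Prop) : Prop :=
  ideal P /\ ~ P one /\
  (forall f g : IVE, P (mult f g) -> P f \/ P g).

Definition irreducible_divisors (f : IVE) : IVE -> Prop :=
  fun q => irreducible q /\ divides q f.

(* The multiset of zeros of [f], encoded as a set of pairs [(a, k)] with
   [1 <= k]: the [k]-th copy of [a] occurs iff [a] is a zero of [f] of
   multiplicity at least [k], so that intersections of such sets are
   intersections of multisets. *)
Definition zeros (f : IVE) : C * nat -> Prop :=
  fun x => (1 <= snd x)%nat /\
    exists g : C -> C, entire g /\
      forall z : C, f z = (Cpow (z - fst x) (snd x) * g z)%C.

Definition intersection {U : Type} (P : IVE -> Prop) (S : IVE -> U -> Prop) :
  U -> Prop := fun x => forall f : IVE, P f -> S f x.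

Definition nonempty {U : Type} (A : U -> Prop) : Prop := exists x, A x.

Definition value_divisible (p n : Z) (f : IVE) : Prop :=
  exists m : Z, f (ZtoC n) = ZtoC m /\ (p | m)%Z.

(* Main.v *)
Require Import Defs.
From Stdlib Require Import Reals ZArith Znumtheory.
From Stdlib Require Import Lra Lia Classical ClassicalEpsilon.
From Coquelicot Require Import Coquelicot.

(** Suppose first that all members of [P] vanish at [a].  Every [f] of the ring
    with [f a = 0] is then in [P]: a suitable power of [f], times an element not
    vanishing at [a], is a multiple of a given nonzero member [f0] of [P], because
    the power compensates the order [k] of the zero of [f0] at [a].  The other
    factor is obtained by modifying [f0 / (z - a) ^ k] with an entire function
    that interpolates [(z - a) ^ k] at the integers other than [a]
    ([prime_ideal_of_zero]).

    Suppose now that the members of [P] have no common zero.  An irreducible [q]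
    dividing all of them has no zeros.  Not being a unit, it takes at some integer
    [n] a value divisible by a prime [p].  Let [E] be the element without zeros
    that is [p] at [n] and 1 at the other integers ([prime_at]).  An element is
    divisible by [E] as soon as its value at [n] is divisible by [p]; hence [E]
    divides [q], and so every member of [P].  Some member does not vanish at [n];
    removing from it as many factors [E] as possible shows that [E] is in [P].
    Hence [P] is the principal ideal of [E], which consists of the elements whose
    value at [n] is divisible by [p].

    Differentiability here is only pointwise, and two facts of complex analysis
    are needed: an entire function vanishing at [a] is [z - a] times an entire
    function ([removable]), and a nonzero one has a finite order at [a]
    ([finite_order]).  Both follow from Cauchy's formula on circles about 0
    ([Cauchy_formula]).  That formula holds because the difference quotient of an
    entire function has a primitive on the plane, by Goursat's lemma for
    rectangles ([Goursat]). *)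

(** * Complex differentiability *)

Lemma continuous_C_eps (f : C -> C) (z : C) :
  continuous f z <->
  forall eps : R, 0 < eps -> exists d : R, 0 < d /\
    forall w : C, Cmod (w - z) < d -> Cmod (f w - f z) < eps.
Proof.
  split.
  - intros H eps He.
    assert (Hs : 0 < sqrt 2) by (apply sqrt_lt_R0; lra).
    assert (He' : 0 < eps / sqrt 2) by (apply Rdiv_lt_0_compat; lra).
    destruct (proj1 (filterlim_locally f (f z)) H (mkposreal _ He')) as [d Hd].
    exists d; split; [apply cond_pos|].
    intros w Hw.
    replace eps with (sqrt 2 * (eps / sqrt 2)) by (field; lra).
    apply (C_NormedModule_mixin_compat2 (f z) (f w) (mkposreal _ He')).
    apply Hd. now apply C_NormedModule_mixin_compat1.
  - intros H. apply filterlim_locally; intros eps.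
    destruct (H eps (cond_pos eps)) as [d [Hd Hf]].
    assert (Hs : 0 < sqrt 2) by (apply sqrt_lt_R0; lra).
    assert (Hd' : 0 < d / sqrt 2) by (apply Rdiv_lt_0_compat; lra).
    exists (mkposreal _ Hd'); intros w Hw.
    apply C_NormedModule_mixin_compat1, Hf.
    replace d with (sqrt 2 * (d / sqrt 2)) by (field; lra).
    exact (C_NormedModule_mixin_compat2 z w (mkposreal _ Hd') Hw).
Qed.

(** The neighbourhoods in [is_derive] over [C_AbsRing] are those of the modulus;
    the balls of the product uniform structure on [C] do not appear here. *)
Lemma is_derive_C_eps (f : C -> C) (z l : C) :
  @is_derive C_AbsRing C_NormedModule f z l <->
  forall eps : R, 0 < eps -> exists d : R, 0 < d /\
    forall w : C, Cmod (w - z) < d ->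
      Cmod (f w - f z - (w - z) * l) <= eps * Cmod (w - z).
Proof.
  split.
  - intros [_ H] eps He.
    destruct (H z (fun P HP => HP) (mkposreal _ He)) as [d Hd].
    exists d; split; [apply cond_pos|]. exact Hd.
  - intros H; split; [apply is_linear_scal_l|].
    intros z' Hz'.
    rewrite <- (@is_filter_lim_locally_unique C_AbsRing
      (AbsRing_NormedModule C_AbsRing) z z' Hz').
    intros eps. destruct (H eps (cond_pos eps)) as [d [Hd Hf]].
    exists (mkposreal d Hd). exact Hf.
Qed.

Section Continuity.
Context {U : UniformSpace}.

Lemma continuous_pair (f g : U -> R) (x : U) :
  continuous f x -> continuous g x -> continuous (fun y => (f y, g y) : C) x.
Proof.
  intros Hf Hg. apply filterlim_locally; intros eps.
  generalize (filter_and _ _ (proj1 (filterlim_locally f (f x)) Hf eps)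
                             (proj1 (filterlim_locally g (g x)) Hg eps)).
  apply filter_imp. intros y [H1 H2]; now split.
Qed.

Lemma continuous_Re (f : U -> C) (x : U) :
  continuous f x -> continuous (fun y => Re (f y)) x.
Proof.
  intros H. apply (continuous_comp f fst); [exact H|].
  destruct (f x); apply continuous_fst.
Qed.

Lemma continuous_Im (f : U -> C) (x : U) :
  continuous f x -> continuous (fun y => Im (f y)) x.
Proof.
  intros H. apply (continuous_comp f snd); [exact H|].
  destruct (f x); apply continuous_snd.
Qed.

Lemma continuous_Cplus (f g : U -> C) (x : U) :
  continuous f x -> continuous g x -> continuous (fun y => f y + g y)%C x.
Proof.
  intros Hf Hg.
  exact (continuous_plus (V := C_R_NormedModule) f g x Hf Hg).
Qed.

Lemma continuous_Copp (f : U -> C) (x : U) :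
  continuous f x -> continuous (fun y => - f y)%C x.
Proof.
  intros Hf. exact (continuous_opp (V := C_R_NormedModule) f x Hf).
Qed.

Lemma continuous_Cminus (f g : U -> C) (x : U) :
  continuous f x -> continuous g x -> continuous (fun y => f y - g y)%C x.
Proof. intros; now apply continuous_Cplus; [|apply continuous_Copp]. Qed.

Lemma continuous_Cmult (f g : U -> C) (x : U) :
  continuous f x -> continuous g x -> continuous (fun y => f y * g y)%C x.
Proof.
  intros Hf Hg.
  assert (Hf1 := continuous_Re _ _ Hf). assert (Hf2 := continuous_Im _ _ Hf).
  assert (Hg1 := continuous_Re _ _ Hg). assert (Hg2 := continuous_Im _ _ Hg).
  apply continuous_pair.
  - apply (continuous_minus (V := R_NormedModule));
      now apply (continuous_mult (K := R_AbsRing)).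
  - apply (continuous_plus (V := R_NormedModule));
      now apply (continuous_mult (K := R_AbsRing)).
Qed.

Lemma continuous_Cinv (f : U -> C) (x : U) :
  continuous f x -> f x <> 0 -> continuous (fun y => / f y)%C x.
Proof.
  intros Hf Hn.
  assert (Hf1 := continuous_Re _ _ Hf). assert (Hf2 := continuous_Im _ _ Hf).
  assert (Hd : continuous (fun y => Re (f y) ^ 2 + Im (f y) ^ 2) x).
  { apply (continuous_plus (V := R_NormedModule));
      (apply (continuous_mult (K := R_AbsRing)); [assumption|];
       apply (continuous_mult (K := R_AbsRing)); [assumption|];
       apply continuous_const). }
  assert (Hd0 : Re (f x) ^ 2 + Im (f x) ^ 2 <> 0).
  { intros H. apply Hn. destruct (f x) as [a b]; unfold Re, Im in H; simpl in H.
    assert (a = 0) by nra. assert (b = 0) by nra. now subst. }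
  assert (Hi : continuous (fun y => / (Re (f y) ^ 2 + Im (f y) ^ 2)) x).
  { apply (continuous_comp _ Rinv); [exact Hd|]. now apply continuous_Rinv. }
  apply continuous_pair; apply (continuous_mult (K := R_AbsRing)); try exact Hi.
  - exact Hf1.
  - apply (continuous_opp (V := R_NormedModule)); exact Hf2.
Qed.

End Continuity.

Lemma C_eq_dec (z w : C) : {z = w} + {z <> w}.
Proof.
  destruct z as [a b], w as [c d].
  destruct (Req_EM_T a c), (Req_EM_T b d); subst;
    [now left | | |]; right; congruence.
Qed.

(** Caratheodory's form of the derivative: [phi] is continuous at [z] and is the
    difference quotient of [f] based at [z]; the derivative is [phi z].  The
    rules for products, composites and inverses become algebraic identities. *)
Definition slope (f : C -> C) (z : C) (phi : C -> C) : Prop :=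
  continuous phi z /\ forall w, (f w = f z + phi w * (w - z))%C.

Lemma is_derive_slope (f : C -> C) (z l : C) :
  @is_derive C_AbsRing C_NormedModule f z l <->
  exists phi, slope f z phi /\ phi z = l.
Proof.
  rewrite is_derive_C_eps. split.
  - intros H.
    exists (fun w => if C_eq_dec w z then l else ((f w - f z) / (w - z))%C).
    repeat split.
    + apply continuous_C_eps; intros eps He.
      destruct (H (eps / 2)) as [d [Hd Hf]]; [lra|].
      exists d; split; [exact Hd|]. intros w Hw.
      destruct (C_eq_dec z z) as [_|]; [|congruence].
      destruct (C_eq_dec w z) as [->|Hn].
      * replace (l - l)%C with (RtoC 0) by ring. now rewrite Cmod_0.
      * assert (Hz : (w - z)%C <> 0).
        { intros E. apply Hn. replace w with ((w - z) + z)%C by ring.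
          rewrite E; ring. }
        assert (Hp := proj1 (Cmod_gt_0 _) Hz).
        replace ((f w - f z) / (w - z) - l)%C
          with ((f w - f z - (w - z) * l) / (w - z))%C by (field; exact Hz).
        rewrite Cmod_div by exact Hz.
        apply Rle_lt_trans with (eps / 2); [|lra].
        apply Rle_div_l; [exact Hp|]. now apply Hf.
    + intros w. destruct (C_eq_dec w z) as [->|Hn]; [ring|]. field.
      intros E. apply Hn. replace w with ((w - z) + z)%C by ring. rewrite E; ring.
    + destruct (C_eq_dec z z); congruence.
  - intros (phi & [Hc Hf] & <-) eps He.
    destruct (proj1 (continuous_C_eps _ _) Hc eps He) as [d [Hd Hp]].
    exists d; split; [exact Hd|]. intros w Hw.
    rewrite Hf.
    replace (f z + phi w * (w - z) - f z - (w - z) * phi z)%C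
      with ((phi w - phi z) * (w - z))%C by ring.
    rewrite Cmod_mult. apply Rmult_le_compat_r; [apply Cmod_ge_0|].
    left; now apply Hp.
Qed.

(** Complex differentiability at a point. *)
Definition Cdiff (f : C -> C) (z : C) : Prop := exists phi, slope f z phi.

Lemma Cdiff_ex_derive (f : C -> C) (z : C) :
  @ex_derive C_AbsRing C_NormedModule f z <-> Cdiff f z.
Proof.
  split.
  - intros [l Hl]. apply is_derive_slope in Hl as (phi & H & _). now exists phi.
  - intros [phi H]. exists (phi z). apply is_derive_slope. now exists phi.
Qed.

Lemma entire_Cdiff (f : C -> C) : entire f <-> forall z, Cdiff f z.
Proof. split; intros H z; now apply Cdiff_ex_derive. Qed.

Lemma Cdiff_const c z : Cdiff (fun _ => c) z.
Proof.
  exists (fun _ => RtoC 0); split; [apply continuous_const|intros; ring].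
Qed.

Lemma Cdiff_id z : Cdiff (fun w => w) z.
Proof.
  exists (fun _ => RtoC 1); split; [apply continuous_const|intros; ring].
Qed.

Lemma slope_continuous f z phi : slope f z phi -> continuous f z.
Proof.
  intros [Hc Hf].
  apply continuous_ext with (fun w => f z + phi w * (w - z))%C; [easy|].
  apply continuous_Cplus; [apply continuous_const|].
  apply continuous_Cmult; [exact Hc|].
  apply continuous_Cminus; [apply continuous_id|apply continuous_const].
Qed.

Lemma Cdiff_continuous f z : Cdiff f z -> continuous f z.
Proof. intros [phi H]; exact (slope_continuous _ _ _ H). Qed.

Lemma Cdiff_plus f g z : Cdiff f z -> Cdiff g z -> Cdiff (fun w => f w + g w)%C z.
Proof.
  intros [p [Hp Ep]] [q [Hq Eq]]. exists (fun w => p w + q w)%C; split.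
  - now apply continuous_Cplus.
  - intros w; rewrite Ep, Eq; ring.
Qed.

Lemma Cdiff_mult f g z : Cdiff f z -> Cdiff g z -> Cdiff (fun w => f w * g w)%C z.
Proof.
  intros [p Hp] [q Hq]. assert (Cg := slope_continuous _ _ _ Hq).
  destruct Hp as [Hp Ep], Hq as [Hq Eq].
  exists (fun w => p w * g w + f z * q w)%C; split.
  - apply continuous_Cplus; apply continuous_Cmult;
      auto using continuous_const.
  - intros w; rewrite Ep, Eq; ring.
Qed.

Lemma Cdiff_ext f g z : (forall w, f w = g w) -> Cdiff f z -> Cdiff g z.
Proof.
  intros E [p [Hp Ep]]. exists p; split; [exact Hp|].
  intros w; rewrite <- !E; apply Ep.
Qed.

(** Differentiability is local: [f] and [g] need only agree near [z]. *)
Lemma Cdiff_ext_loc f g z (d : R) :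
  0 < d -> (forall w, Cmod (w - z) < d -> f w = g w) -> Cdiff f z -> Cdiff g z.
Proof.
  intros Hd E. rewrite <- !Cdiff_ex_derive. intros [l Hl]. exists l.
  rewrite is_derive_C_eps in *. intros eps He.
  destruct (Hl eps He) as [d' [Hd' H]].
  exists (Rmin d d'); split; [now apply Rmin_glb_lt|].
  intros w Hw. rewrite <- !E.
  - apply H. apply Rlt_le_trans with (1 := Hw), Rmin_r.
  - replace (z - z)%C with (RtoC 0) by ring. now rewrite Cmod_0.
  - apply Rlt_le_trans with (1 := Hw), Rmin_l.
Qed.

Lemma Cdiff_comp f g z :
  Cdiff g z -> Cdiff f (g z) -> Cdiff (fun w => f (g w)) z.
Proof.
  intros [q Hq] [p [Hp Ep]]. assert (Cg := slope_continuous _ _ _ Hq).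
  destruct Hq as [Hq Eq].
  exists (fun w => p (g w) * q w)%C; split.
  - apply continuous_Cmult; [|exact Hq]. now apply (continuous_comp g p).
  - intros w; rewrite Ep.
    replace (g w - g z)%C with (q w * (w - z))%C by (rewrite (Eq w); ring). ring.
Qed.

Lemma Cminus_neq_0 (z w : C) : z <> w -> (z - w)%C <> 0.
Proof.
  intros H E; apply H. replace z with ((z - w) + w)%C by ring. rewrite E; ring.
Qed.

Lemma Cdiff_inv (z : C) : z <> 0 -> Cdiff Cinv z.
Proof.
  intros Hz. set (d := Cmod z).
  assert (Hd : 0 < d) by exact (proj1 (Cmod_gt_0 z) Hz).
  (* Near [z], the difference quotient of [1 / w] based at [z] is
     [- 1 / (z w)]. *)
  apply Cdiff_ext_loc with (f := fun w => (/ z + (- (/ z * / w)) * (w - z))%C) (d := d).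
  - exact Hd.
  - intros w Hw. field. split; [|exact Hz].
    intros ->. unfold d in Hw.
    replace (0 - z)%C with (- z)%C in Hw by ring. rewrite Cmod_opp in Hw. lra.
  - exists (fun w => - (/ z * / w))%C; split.
    + apply continuous_Copp, continuous_Cmult; [apply continuous_const|].
      apply (continuous_Cinv (fun w => w)); [apply continuous_id|exact Hz].
    + intros w; generalize (/ w)%C (/ z)%C; intros; ring.
Qed.

(** * Integration of complex-valued functions *)

(** The integral of a complex-valued function of a real variable. *)
Definition CInt (f : R -> C) (a b : R) : C := RInt (V := C_R_CompleteNormedModule) f a b.

Section Integral.
Implicit Types (f g : R -> C) (a b c : R).

Lemma ex_CInt f a b : (forall t, continuous f t) ->
  @ex_RInt C_R_NormedModule f a b.
Proof.
  intros H. apply (ex_RInt_continuous (V := C_R_CompleteNormedModule)).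
  intros t _; apply H.
Qed.

Lemma CInt_correct f a b : (forall t, continuous f t) ->
  @is_RInt C_R_NormedModule f a b (CInt f a b).
Proof.
  intros H. apply (RInt_correct (V := C_R_CompleteNormedModule)), ex_CInt, H.
Qed.

Lemma CInt_unique f a b l :
  @is_RInt C_R_NormedModule f a b l -> CInt f a b = l.
Proof. apply (is_RInt_unique (V := C_R_CompleteNormedModule)). Qed.

Lemma CInt_ext f g a b : (forall t, f t = g t) -> CInt f a b = CInt g a b.
Proof. intros H. apply (RInt_ext (V := C_R_CompleteNormedModule)). intros; apply H. Qed.

Lemma CInt_Chasles f a b c : (forall t, continuous f t) ->
  (CInt f a b + CInt f b c = CInt f a c)%C.
Proof.
  intros H. apply (RInt_Chasles (V := C_R_CompleteNormedModule)); now apply ex_CInt.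
Qed.

Lemma CInt_swap f a b : (forall t, continuous f t) ->
  (CInt f b a = - CInt f a b)%C.
Proof.
  intros H. symmetry. apply (opp_RInt_swap (V := C_R_CompleteNormedModule)).
  now apply ex_CInt.
Qed.

Lemma CInt_minus f g a b :
  (forall t, continuous f t) -> (forall t, continuous g t) ->
  (CInt (fun t => f t - g t) a b = CInt f a b - CInt g a b)%C.
Proof.
  intros Hf Hg. apply CInt_unique.
  apply (is_RInt_minus (V := C_R_NormedModule)); now apply CInt_correct.
Qed.

Lemma CInt_mult (c : C) f a b : (forall t, continuous f t) ->
  (CInt (fun t => c * f t) a b = c * CInt f a b)%C.
Proof.
  intros Hf. apply CInt_unique.
  assert (H := CInt_correct f a b Hf).
  (* A complex factor is not a scalar of the real space [C]: work by components. *)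
  assert (H1 := is_RInt_fct_extend_fst _ _ _ _ H).
  assert (H2 := is_RInt_fct_extend_snd _ _ _ _ H).
  apply (is_RInt_fct_extend_pair (U := R_NormedModule) (V := R_NormedModule)).
  - apply (is_RInt_minus (V := R_NormedModule));
      now apply (is_RInt_scal (V := R_NormedModule)).
  - apply (is_RInt_plus (V := R_NormedModule));
      now apply (is_RInt_scal (V := R_NormedModule)).
Qed.

Lemma CInt_bound f a b M : (forall t, continuous f t) ->
  (forall t, Rmin a b <= t <= Rmax a b -> Cmod (f t) <= M) ->
  Cmod (CInt f a b) <= Rabs (b - a) * M.
Proof.
  intros Hc H. rewrite Cmod_norm.
  apply (norm_RInt_le_const_abs (V := C_R_NormedModule) f a b).
  - intros t Ht. rewrite <- Cmod_norm. now apply H.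
  - now apply CInt_correct.
Qed.

Lemma CInt_const (c : C) a b : CInt (fun _ => c) a b = (RtoC (b - a) * c)%C.
Proof.
  unfold CInt. rewrite (RInt_const (V := C_R_CompleteNormedModule)).
  destruct c as [x y]. apply injective_projections; simpl;
    unfold scal; simpl; unfold mult; simpl; ring.
Qed.

Lemma CInt_derive (F f : R -> C) a b :
  (forall t, @is_derive R_AbsRing C_R_NormedModule F t (f t)) ->
  (forall t, continuous f t) ->
  CInt f a b = (F b - F a)%C.
Proof.
  intros HF Hf. apply CInt_unique.
  apply (is_RInt_derive (V := C_R_CompleteNormedModule)); auto.
Qed.

End Integral.

(** Chain rule along a path: [F] is complex differentiable and [gamma] is a
    differentiable path in [C]. *)
Lemma is_derive_path (F : C -> C) (phi : C -> C) (gamma : R -> C) (t : R) (l : C) :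
  slope F (gamma t) phi -> @is_derive R_AbsRing C_R_NormedModule gamma t l ->
  @is_derive R_AbsRing C_R_NormedModule (fun s => F (gamma s)) t
    (phi (gamma t) * l)%C.
Proof.
  intros [Hphi E] Hg.
  assert (Cg : continuous gamma t).
  { apply (ex_derive_continuous (V := C_R_NormedModule) gamma). now exists l. }
  assert (Cp : continuous (fun s => phi (gamma s)) t)
    by now apply (continuous_comp gamma phi).
  destruct Hg as [_ Hg]. split; [apply is_linear_scal_l|].
  intros t' Ht'. rewrite <- (is_filter_lim_locally_unique t t' Ht').
  specialize (Hg t (fun P HP => HP)). clear t' Ht'.
  set (A := Cmod (phi (gamma t)) + 1). set (B := Cmod l + 1).
  assert (HA : 0 < A) by (unfold A; generalize (Cmod_ge_0 (phi (gamma t))); lra).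
  assert (HB : 0 < B) by (unfold B; generalize (Cmod_ge_0 l); lra).
  intros eps.
  assert (He1 : 0 < eps / (2 * B)).
  { apply Rdiv_lt_0_compat; [apply cond_pos|lra]. }
  assert (He2 : 0 < Rmin 1 (eps / (2 * A))).
  { apply Rmin_glb_lt; [lra|]. apply Rdiv_lt_0_compat; [apply cond_pos|lra]. }
  assert (Hp : locally t (fun s => Cmod (phi (gamma s) - phi (gamma t)) <= eps / (2 * B))).
  { assert (Hs : 0 < eps / (2 * B) / sqrt 2).
    { apply Rdiv_lt_0_compat; [exact He1|apply sqrt_lt_R0; lra]. }
    generalize (proj1 (filterlim_locally _ _) Cp (mkposreal _ Hs)).
    apply filter_imp. intros s H. left.
    replace (eps / (2 * B)) with (sqrt 2 * (eps / (2 * B) / sqrt 2)).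
    - exact (C_NormedModule_mixin_compat2 _ _ (mkposreal _ Hs) H).
    - field. assert (0 < sqrt 2) by (apply sqrt_lt_R0; lra). lra. }
  generalize (filter_and _ _ Hp (Hg (mkposreal _ He2))).
  apply filter_imp. intros s [H1 H2].
  change (norm (minus s t)) with (Rabs (s - t)) in *.
  rewrite <- Cmod_norm in *.
  set (d := (RtoC (s - t)) : C).
  assert (Ed : Cmod d = Rabs (s - t)) by apply Cmod_R.
  assert (Esc : forall c : C, @scal R_AbsRing C_R_NormedModule (minus s t) c = (d * c)%C).
  { intros [x y]. unfold d. apply injective_projections; simpl;
      unfold scal; simpl; unfold mult, minus, plus, opp; simpl; ring. }
  rewrite Esc in *.
  change (Cmod (gamma s - gamma t - d * l) <= Rmin 1 (eps / (2 * A)) * Rabs (s - t)) in H2.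
  change (Cmod (F (gamma s) - F (gamma t) - d * (phi (gamma t) * l)) <= eps * Rabs (s - t)).
  rewrite E.
  set (q := (gamma s - gamma t - d * l)%C) in *.
  set (p := (phi (gamma s) - phi (gamma t))%C) in *.
  replace (F (gamma t) + phi (gamma s) * (gamma s - gamma t) - F (gamma t)
           - d * (phi (gamma t) * l))%C
    with (phi (gamma t) * q + p * (q + d * l))%C by (unfold p, q; ring).
  assert (Hq1 : Cmod q <= Rabs (s - t)).
  { apply Rle_trans with (1 := H2). rewrite <- (Rmult_1_l (Rabs (s - t))) at 2.
    apply Rmult_le_compat_r; [apply Rabs_pos|apply Rmin_l]. }
  assert (Hq2 : Cmod q <= eps / (2 * A) * Rabs (s - t)).
  { apply Rle_trans with (1 := H2).
    apply Rmult_le_compat_r; [apply Rabs_pos|apply Rmin_r]. }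
  assert (Hqd : Cmod (q + d * l) <= B * Rabs (s - t)).
  { apply Rle_trans with (1 := Cmod_triangle _ _).
    rewrite Cmod_mult, Ed. unfold B. lra. }
  apply Rle_trans with (1 := Cmod_triangle _ _). rewrite !Cmod_mult.
  assert (K1 : Cmod (phi (gamma t)) * Cmod q <= A * (eps / (2 * A) * Rabs (s - t))).
  { apply Rmult_le_compat; try apply Cmod_ge_0; [unfold A; lra|exact Hq2]. }
  assert (K2 : Cmod p * Cmod (q + d * l) <= eps / (2 * B) * (B * Rabs (s - t))).
  { apply Rmult_le_compat; try apply Cmod_ge_0; assumption. }
  replace (eps * Rabs (s - t)) with
    (A * (eps / (2 * A) * Rabs (s - t)) + eps / (2 * B) * (B * Rabs (s - t)))
    by (field; lra).
  lra.
Qed.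

Lemma is_derive_pair (u v : R -> R) (t a b : R) :
  is_derive u t a -> is_derive v t b ->
  @is_derive R_AbsRing C_R_NormedModule (fun s => (u s, v s)) t (a, b).
Proof.
  intros [_ Hu] [_ Hv]. split; [apply is_linear_scal_l|].
  intros t' Ht'. specialize (Hu t' Ht'). specialize (Hv t' Ht').
  intros eps.
  assert (He : 0 < eps / 2) by (generalize (cond_pos eps); lra).
  generalize (filter_and _ _ (Hu (mkposreal _ He)) (Hv (mkposreal _ He))).
  apply filter_imp. intros s [H1 H2]. rewrite <- Cmod_norm.
  change (Rabs (u s - u t' - (s - t') * a) <= eps / 2 * Rabs (s - t')) in H1.
  change (Rabs (v s - v t' - (s - t') * b) <= eps / 2 * Rabs (s - t')) in H2.
  change (Cmod (u s - u t' - (s - t') * a, v s - v t' - (s - t') * b)%R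
          <= eps * Rabs (s - t')).
  set (x := u s - u t' - (s - t') * a) in *.
  set (y := v s - v t' - (s - t') * b) in *.
  replace ((x, y) : C) with (RtoC x + Ci * RtoC y)%C
    by (apply injective_projections; simpl; ring).
  apply Rle_trans with (1 := Cmod_triangle _ _).
  rewrite Cmod_mult, Cmod_Ci, !Cmod_R. lra.
Qed.

(** * Goursat's lemma *)

(** The integrals of [h z dz] along a horizontal segment at height [c], along a
    vertical segment at abscissa [a], and around the rectangle with opposite
    corners [(a, c)] and [(b, d)]. *)
Definition CIhor (h : C -> C) (a b c : R) : C := CInt (fun x => h (x, c)) a b.
Definition CIver (h : C -> C) (a c d : R) : C :=
  CInt (fun y => Ci * h (a, y))%C c d.
Definition CIrect (h : C -> C) (a b c d : R) : C :=
  (CIhor h a b c + CIver h b c d - CIhor h a b d - CIver h a c d)%C.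

Lemma continuous_hor (h : C -> C) (c : R) :
  (forall z, continuous h z) -> forall x : R, continuous (fun x => h (x, c)) x.
Proof.
  intros H x. apply (continuous_comp (fun x => (x, c) : C) h); [|apply H].
  apply continuous_pair; [apply continuous_id|apply continuous_const].
Qed.

Lemma continuous_ver (h : C -> C) (a : R) :
  (forall z, continuous h z) ->
  forall y : R, continuous (fun y => Ci * h (a, y))%C y.
Proof.
  intros H y. apply continuous_Cmult; [apply continuous_const|].
  apply (continuous_comp (fun y => (a, y) : C) h); [|apply H].
  apply continuous_pair; [apply continuous_const|apply continuous_id].
Qed.

Section Rectangles.
Variable h : C -> C.
Hypothesis h_cont : forall z, continuous h z.

Lemma CIrect_split_hor a m b c d :
  (CIrect h a b c d = CIrect h a m c d + CIrect h m b c d)%C.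
Proof.
  unfold CIrect, CIhor.
  rewrite <- (CInt_Chasles (fun x => h (x, c)) a m b) by now apply continuous_hor.
  rewrite <- (CInt_Chasles (fun x => h (x, d)) a m b) by now apply continuous_hor.
  ring.
Qed.

Lemma CIrect_split_ver a b c m d :
  (CIrect h a b c d = CIrect h a b c m + CIrect h a b m d)%C.
Proof.
  unfold CIrect, CIver.
  rewrite <- (CInt_Chasles (fun y => Ci * h (a, y))%C c m d) by now apply continuous_ver.
  rewrite <- (CInt_Chasles (fun y => Ci * h (b, y))%C c m d) by now apply continuous_ver.
  ring.
Qed.

Lemma CIrect_swap_hor a b c d : (CIrect h b a c d = - CIrect h a b c d)%C.
Proof.
  unfold CIrect, CIhor.
  rewrite !(CInt_swap _ a b) by now apply continuous_hor. ring.
Qed.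

Lemma CIrect_swap_ver a b c d : (CIrect h a b d c = - CIrect h a b c d)%C.
Proof.
  unfold CIrect, CIver.
  rewrite !(CInt_swap _ c d) by now apply continuous_ver. ring.
Qed.

Lemma CIrect_bound a b c d M :
  (forall x y, Rmin a b <= x <= Rmax a b -> Rmin c d <= y <= Rmax c d ->
     Cmod (h (x, y)) <= M) ->
  Cmod (CIrect h a b c d) <= 2 * (Rabs (b - a) + Rabs (d - c)) * M.
Proof.
  intros H.
  assert (Hh : forall e, Rmin c d <= e <= Rmax c d ->
            Cmod (CIhor h a b e) <= Rabs (b - a) * M).
  { intros e He. apply CInt_bound; [now apply continuous_hor|auto]. }
  assert (Hv : forall e, Rmin a b <= e <= Rmax a b ->
            Cmod (CIver h e c d) <= Rabs (d - c) * M).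
  { intros e He. apply CInt_bound; [now apply continuous_ver|].
    intros t Ht. rewrite Cmod_mult, Cmod_Ci, Rmult_1_l. auto. }
  assert (H1 := Hh c). assert (H2 := Hh d).
  assert (H3 := Hv a). assert (H4 := Hv b).
  generalize (Rmin_l c d) (Rmin_r c d) (Rmax_l c d) (Rmax_r c d)
    (Rmin_l a b) (Rmin_r a b) (Rmax_l a b) (Rmax_r a b); intros.
  unfold CIrect, Cminus.
  apply Rle_trans with (1 := Cmod_triangle _ _).
  generalize (Cmod_triangle (CIhor h a b c + CIver h b c d) (- CIhor h a b d))
    (Cmod_triangle (CIhor h a b c) (CIver h b c d)).
  rewrite !Cmod_opp. lra.
Qed.

End Rectangles.

Lemma CIhor_primitive (H h : C -> C) (a b c : R) :
  (forall z, continuous h z) ->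
  (forall z, exists phi, slope H z phi /\ phi z = h z) ->
  CIhor h a b c = (H (b, c) - H (a, c))%C.
Proof.
  intros Hh HH. apply (CInt_derive (fun x => H (x, c))).
  - intros t. destruct (HH (t, c)) as (phi & Hs & E).
    assert (Hg := is_derive_pair (fun x => x) (fun _ => c) t 1 0
      (@is_derive_id R_AbsRing t) (@is_derive_const R_AbsRing R_NormedModule c t)).
    assert (D := is_derive_path H phi _ t 1%C Hs Hg).
    refine (eq_rect _ (@is_derive R_AbsRing C_R_NormedModule _ t) D _ _).
    exact (eq_trans (Cmult_1_r _) E).
  - now apply continuous_hor.
Qed.

Lemma CIver_primitive (H h : C -> C) (a c d : R) :
  (forall z, continuous h z) ->
  (forall z, exists phi, slope H z phi /\ phi z = h z) ->
  CIver h a c d = (H (a, d) - H (a, c))%C.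
Proof.
  intros Hh HH. apply (CInt_derive (fun y => H (a, y))).
  - intros t. destruct (HH (a, t)) as (phi & Hs & E).
    assert (Hg := is_derive_pair (fun _ => a) (fun y => y) t 0 1
      (@is_derive_const R_AbsRing R_NormedModule a t) (@is_derive_id R_AbsRing t)).
    assert (D := is_derive_path H phi _ t Ci Hs Hg).
    refine (eq_rect _ (@is_derive R_AbsRing C_R_NormedModule _ t) D _ _).
    exact (eq_trans (Cmult_comm _ _) (f_equal (Cmult Ci) E)).
  - now apply continuous_ver.
Qed.

Lemma CIrect_primitive (H h : C -> C) (a b c d : R) :
  (forall z, continuous h z) ->
  (forall z, exists phi, slope H z phi /\ phi z = h z) ->
  CIrect h a b c d = 0.
Proof.
  intros Hh HH. unfold CIrect.
  rewrite !(CIhor_primitive H h), !(CIver_primitive H h) by assumption. ring.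
Qed.

Lemma CIrect_minus (h g : C -> C) (a b c d : R) :
  (forall z, continuous h z) -> (forall z, continuous g z) ->
  CIrect (fun z => h z - g z)%C a b c d = (CIrect h a b c d - CIrect g a b c d)%C.
Proof.
  intros Hh Hg.
  assert (E1 : forall e, CIhor (fun z => h z - g z)%C a b e
                         = (CIhor h a b e - CIhor g a b e)%C).
  { intros e. apply CInt_minus; now apply continuous_hor. }
  assert (E2 : forall e, CIver (fun z => h z - g z)%C e c d
                         = (CIver h e c d - CIver g e c d)%C).
  { intros e. unfold CIver.
    rewrite <- CInt_minus by now apply continuous_ver.
    apply CInt_ext; intros; ring. }
  unfold CIrect. rewrite !E1, !E2. ring.
Qed.

(** An affine function has a quadratic primitive. *)
Lemma CIrect_affine (u v z0 : C) (a b c d : R) :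
  CIrect (fun z => u + v * (z - z0))%C a b c d = 0.
Proof.
  apply CIrect_primitive with (fun z => u * z + v * ((z - z0) * (z - z0) / 2))%C.
  - intros z. apply Cdiff_continuous.
    exists (fun _ => v); split; [apply continuous_const|intros; ring].
  - intros z. exists (fun w => u + v * ((w - z0) + (z - z0)) / 2)%C. repeat split.
    + apply Cdiff_continuous. exists (fun _ => v / 2)%C.
      split; [apply continuous_const|intros; field].
    + intros w. field.
    + field.
Qed.

(** The closed intervals from [s n] to [s n + A / 2 ^ n] are nested, hence share a
    point. *)
Lemma bisection_limit (s : nat -> R) (A : R) :
  0 <= A -> (forall n, s n <= s (S n) <= s n + A / 2 ^ S n) ->
  exists x, forall n, s n <= x <= s n + A / 2 ^ n.
Proof.
  intros HA H.
  assert (Hp : forall n, 0 < 2 ^ n) by (intros; apply pow_lt; lra).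
  assert (Hdec : forall n, s (S n) + A / 2 ^ S n <= s n + A / 2 ^ n).
  { intros n. specialize (H n). assert (Hn := Hp n).
    replace (A / 2 ^ n) with (A / 2 ^ S n + A / 2 ^ S n); [lra|].
    simpl; field; lra. }
  assert (Hup : forall n k, s (n + k)%nat + A / 2 ^ (n + k) <= s n + A / 2 ^ n).
  { intros n k; induction k as [|k IH]; [rewrite Nat.add_0_r; lra|].
    rewrite Nat.add_succ_r. apply Rle_trans with (2 := IH), Hdec. }
  assert (Hlo : forall n k, s n <= s (n + k)%nat).
  { intros n k; induction k as [|k IH]; [rewrite Nat.add_0_r; lra|].
    rewrite Nat.add_succ_r. apply Rle_trans with (1 := IH), H. }
  assert (Hpos : forall n, 0 <= A / 2 ^ n).
  { intros n. apply Rdiv_le_0_compat; auto. }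
  assert (Hb : forall n m, s m <= s n + A / 2 ^ n).
  { intros n m. destruct (Nat.le_ge_cases n m) as [L|L].
    - replace m with (n + (m - n))%nat by lia.
      generalize (Hup n (m - n)%nat) (Hpos (n + (m - n))%nat). lra.
    - replace n with (m + (n - m))%nat by lia.
      generalize (Hlo m (n - m)%nat) (Hpos (m + (n - m))%nat). lra. }
  destruct (completeness (fun x => exists n, x = s n)) as [x [Hx1 Hx2]].
  - exists (s O + A / 2 ^ O). intros y [n ->]. apply Hb.
  - now exists (s O), O.
  - exists x. intros n; split.
    + apply Hx1. now exists n.
    + apply Hx2. intros y [m ->]. apply Hb.
Qed.

(** Goursat's lemma, by repeated quartering.  The integrals around the chosen
    rectangles decrease no faster than [4 ^ -n], while differentiability at their
    common point bounds them by an arbitrarily small multiple of [4 ^ -n]. *)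
Lemma Goursat_le (h : C -> C) (a b c d : R) :
  (forall z, continuous h z) -> a <= b -> c <= d ->
  (forall x y, a <= x <= b -> c <= y <= d -> Cdiff h (x, y)) ->
  CIrect h a b c d = 0.
Proof.
  intros Hc Hab Hcd Hd.
  set (A := b - a). set (B := d - c).
  assert (HA : 0 <= A) by (unfold A; lra). assert (HB : 0 <= B) by (unfold B; lra).
  assert (Hp : forall n, 0 < 2 ^ n) by (intros; apply pow_lt; lra).
  set (J := fun n (p : R * R) =>
    CIrect h (fst p) (fst p + A / 2 ^ n) (snd p) (snd p + B / 2 ^ n)).
  (* One of the four quarters carries at least a quarter of the integral. *)
  assert (Hstep : forall n p, exists q,
    (fst p <= fst q <= fst p + A / 2 ^ S n) /\
    (snd p <= snd q <= snd p + B / 2 ^ S n) /\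
    Cmod (J n p) <= 4 * Cmod (J (S n) q)).
  { intros n [x y]. set (a' := A / 2 ^ S n). set (b' := B / 2 ^ S n).
    assert (Ha' : 0 <= a') by (apply Rdiv_le_0_compat; auto).
    assert (Hb' : 0 <= b') by (apply Rdiv_le_0_compat; auto).
    assert (E : J n (x, y) = (J (S n) (x, y) + J (S n) (x, (y + b')%R)
              + (J (S n) ((x + a')%R, y) + J (S n) ((x + a')%R, (y + b')%R)))%C).
    { unfold J; cbn [fst snd]. fold a' b'.
      replace (x + A / 2 ^ n) with (x + a' + a')
        by (unfold a'; simpl; field; apply Rgt_not_eq, Hp).
      replace (y + B / 2 ^ n) with (y + b' + b')
        by (unfold b'; simpl; field; apply Rgt_not_eq, Hp).
      rewrite (CIrect_split_hor h Hc x (x + a') (x + a' + a')).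
      rewrite (CIrect_split_ver h Hc x (x + a') y (y + b')).
      rewrite (CIrect_split_ver h Hc (x + a') (x + a' + a') y (y + b')).
      reflexivity. }
    assert (T : Cmod (J n (x, y)) <=
      Cmod (J (S n) (x, y)) + Cmod (J (S n) (x, (y + b')%R))
      + Cmod (J (S n) ((x + a')%R, y)) + Cmod (J (S n) ((x + a')%R, (y + b')%R))).
    { rewrite E.
      generalize (Cmod_triangle (J (S n) (x, y) + J (S n) (x, (y + b')%R))
          (J (S n) ((x + a')%R, y) + J (S n) ((x + a')%R, (y + b')%R)))
        (Cmod_triangle (J (S n) (x, y)) (J (S n) (x, (y + b')%R)))
        (Cmod_triangle (J (S n) ((x + a')%R, y)) (J (S n) ((x + a')%R, (y + b')%R))).
      lra. }
    assert (K : forall q, Cmod (J n (x, y)) <= 4 * Cmod (J (S n) q) \/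
                          4 * Cmod (J (S n) q) < Cmod (J n (x, y))).
    { intros q. destruct (Rle_dec (Cmod (J n (x, y))) (4 * Cmod (J (S n) q)));
        [now left|right; lra]. }
    destruct (K (x, y)); [exists (x, y); simpl fst; simpl snd; repeat split; trivial; lra|].
    destruct (K (x, (y + b')%R));
      [exists (x, (y + b')%R); simpl fst; simpl snd; repeat split; trivial; lra|].
    destruct (K ((x + a')%R, y));
      [exists ((x + a')%R, y); simpl fst; simpl snd; repeat split; trivial; lra|].
    exists ((x + a')%R, (y + b')%R); simpl fst; simpl snd; repeat split; lra. }
  assert (Hseq : exists s : nat -> R * R, s O = (a, c) /\ forall n,
    (fst (s n) <= fst (s (S n)) <= fst (s n) + A / 2 ^ S n) /\
    (snd (s n) <= snd (s (S n)) <= snd (s n) + B / 2 ^ S n) /\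
    Cmod (J n (s n)) <= 4 * Cmod (J (S n) (s (S n)))).
  { set (next := fun n p =>
      proj1_sig (ClassicalEpsilon.constructive_indefinite_description _ (Hstep n p))).
    exists (fix s n := match n with O => (a, c) | S n => next n (s n) end).
    split; [reflexivity|]. intros n.
    apply (proj2_sig (ClassicalEpsilon.constructive_indefinite_description _
      (Hstep n ((fix s n := match n with O => (a, c) | S n => next n (s n) end) n)))). }
  destruct Hseq as (s & Hs0 & Hs).
  destruct (bisection_limit (fun n => fst (s n)) A HA) as [x Hx]; [intros n; apply Hs|].
  destruct (bisection_limit (fun n => snd (s n)) B HB) as [y Hy]; [intros n; apply Hs|].
  assert (Hgrow : forall n, Cmod (CIrect h a b c d) <= 4 ^ n * Cmod (J n (s n))).
  { induction n as [|n IH].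
    - rewrite Hs0. unfold J; simpl.
      replace (a + A / 1) with b by (unfold A; field).
      replace (c + B / 1) with d by (unfold B; field). lra.
    - apply Rle_trans with (1 := IH). destruct (Hs n) as (_ & _ & H).
      change (4 ^ S n) with (4 * 4 ^ n).
      assert (0 < 4 ^ n) by (apply pow_lt; lra). nra. }
  destruct (Hd x y) as [phi [Hphi E]].
  { generalize (Hx O). rewrite Hs0; simpl. unfold A. lra. }
  { generalize (Hy O). rewrite Hs0; simpl. unfold B. lra. }
  apply Cmod_eq_0. apply Rle_antisym; [|apply Cmod_ge_0].
  apply le_epsilon; intros eps He. rewrite Rplus_0_l.
  set (L := 2 * (A + B) * (A + B) + 1).
  assert (HL : 0 < L) by (unfold L; nra).
  destruct (proj1 (continuous_C_eps _ _) Hphi (eps / L)) as [del [Hdel Hb]].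
  { now apply Rdiv_lt_0_compat. }
  assert (Hn : exists n, (A + B) / 2 ^ n < del).
  { destruct (pow_lt_1_zero (/ 2)) with (y := del / (A + B + 1)) as [N HN].
    - rewrite Rabs_pos_eq; lra.
    - apply Rdiv_lt_0_compat; lra.
    - exists N. specialize (HN N (le_n N)).
      rewrite Rabs_pos_eq in HN by (apply pow_le; lra).
      rewrite pow_inv in HN.
      apply Rlt_div_r in HN; [|lra].
      assert (0 < / 2 ^ N) by apply Rinv_0_lt_compat, Hp.
      unfold Rdiv. nra. }
  destruct Hn as [n Hn].
  apply Rle_trans with (1 := Hgrow n).
  set (k := phi (x, y)).
  (* Removing the affine part of [h] at the common point changes no integral. *)
  assert (Ej : J n (s n) = CIrect (fun z => h z - (h (x, y) + k * (z - (x, y))))%C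
     (fst (s n)) (fst (s n) + A / 2 ^ n) (snd (s n)) (snd (s n) + B / 2 ^ n)).
  { rewrite CIrect_minus, CIrect_affine; [unfold J; ring|exact Hc|].
    intros z. apply Cdiff_continuous.
    exists (fun _ => k); split; [apply continuous_const|intros; ring]. }
  assert (HAn : 0 <= A / 2 ^ n) by (apply Rdiv_le_0_compat; auto).
  assert (HBn : 0 <= B / 2 ^ n) by (apply Rdiv_le_0_compat; auto).
  specialize (Hx n). specialize (Hy n). simpl in Hx, Hy.
  rewrite Ej.
  apply Rle_trans with (4 ^ n * (2 * (A / 2 ^ n + B / 2 ^ n) *
     (eps / L * (A / 2 ^ n + B / 2 ^ n)))).
  - apply Rmult_le_compat_l; [apply pow_le; lra|].
    eapply Rle_trans; [apply CIrect_bound with (M := eps / L * (A / 2 ^ n + B / 2 ^ n))|].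
    + intros z. apply continuous_Cminus; [apply Hc|]. apply Cdiff_continuous.
      exists (fun _ => k); split; [apply continuous_const|intros; ring].
    + intros x' y'. rewrite Rmin_left, Rmax_right by lra.
      rewrite Rmin_left, Rmax_right by lra. intros Hx' Hy'.
      rewrite E.
      replace (h (x, y) + phi (x', y') * ((x', y') - (x, y)) -
         (h (x, y) + k * ((x', y') - (x, y))))%C
        with ((phi (x', y') - k) * ((x', y') - (x, y)))%C by ring.
      assert (Hz : Cmod ((x', y') - (x, y)) <= A / 2 ^ n + B / 2 ^ n).
      { replace ((x', y') - (x, y))%C with (RtoC (x' - x) + Ci * RtoC (y' - y))%C
          by (apply injective_projections; simpl; ring).
        apply Rle_trans with (1 := Cmod_triangle _ _).
        rewrite Cmod_mult, Cmod_Ci, !Cmod_R, Rmult_1_l.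
        apply Rplus_le_compat; apply Rabs_le; lra. }
      rewrite Cmod_mult. apply Rmult_le_compat; try apply Cmod_ge_0; [|exact Hz].
      left. apply Hb. apply Rle_lt_trans with (1 := Hz).
      unfold Rdiv in *. lra.
    + replace (fst (s n) + A / 2 ^ n - fst (s n)) with (A / 2 ^ n) by ring.
      replace (snd (s n) + B / 2 ^ n - snd (s n)) with (B / 2 ^ n) by ring.
      rewrite !Rabs_pos_eq by assumption. lra.
  - replace (4 ^ n) with (2 ^ n * 2 ^ n)
      by (rewrite <- Rpow_mult_distr; f_equal; ring).
    assert (Hn0 := Hp n).
    replace (2 ^ n * 2 ^ n * (2 * (A / 2 ^ n + B / 2 ^ n) *
      (eps / L * (A / 2 ^ n + B / 2 ^ n)))) with (2 * (A + B) * (A + B) * (eps / L))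
      by (field; lra).
    apply Rle_trans with (L * (eps / L)); [|right; field; lra].
    apply Rmult_le_compat_r; [left; now apply Rdiv_lt_0_compat|unfold L; lra].
Qed.

(** The same without any assumption on the order of the vertices. *)
Lemma Goursat (h : C -> C) (a b c d : R) :
  (forall z, continuous h z) ->
  (forall x y, Rmin a b <= x <= Rmax a b -> Rmin c d <= y <= Rmax c d ->
     Cdiff h (x, y)) ->
  CIrect h a b c d = 0.
Proof.
  intros Hc H.
  destruct (Rle_dec a b) as [Hab|Hab], (Rle_dec c d) as [Hcd|Hcd];
    rewrite ?(Rmin_left a b), ?(Rmax_right a b), ?(Rmin_right a b), ?(Rmax_left a b),
      ?(Rmin_left c d), ?(Rmax_right c d), ?(Rmin_right c d), ?(Rmax_left c d) in H by lra.
  - now apply Goursat_le.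
  - rewrite CIrect_swap_ver, Goursat_le; trivial; try lra. ring.
  - rewrite CIrect_swap_hor, Goursat_le; trivial; try lra. ring.
  - rewrite CIrect_swap_hor, CIrect_swap_ver, Goursat_le; trivial; try lra. ring.
Qed.

(** * Primitives *)

(** Goursat's lemma still holds if [h] is only continuous at one corner: the
    rectangles away from that corner contribute nothing, and the one that
    remains is arbitrarily small. *)
Lemma CIrect_corner (h : C -> C) (x y : R) :
  (forall z, continuous h z) -> (forall z : C, z <> 0 -> Cdiff h z) ->
  CIrect h 0 x 0 y = 0.
Proof.
  intros Hc Hd.
  assert (Z : forall J : C, J = (- J)%C -> J = 0).
  { intros [u v] E. injection E; intros. apply injective_projections; simpl; lra. }
  destruct (Req_dec x 0) as [->|Hx].
  { apply Z. now apply CIrect_swap_hor. }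
  destruct (Req_dec y 0) as [->|Hy].
  { apply Z. now apply CIrect_swap_ver. }
  set (L := Rabs x + Rabs y).
  assert (HL : 0 < L).
  { unfold L. generalize (Rabs_pos_lt x Hx) (Rabs_pos y). lra. }
  destruct (proj1 (continuous_C_eps h (RtoC 0)) (Hc (RtoC 0)) 1 Rlt_0_1) as [d [Hd0 Hb]].
  set (M := Cmod (h (RtoC 0)) + 1).
  assert (HM : 0 < M) by (unfold M; generalize (Cmod_ge_0 (h 0)); lra).
  assert (Hloc : forall z, Cmod z < d -> Cmod (h z) <= M).
  { intros z Hz. replace (h z) with ((h z - h (RtoC 0)) + h (RtoC 0))%C by ring.
    apply Rle_trans with (1 := Cmod_triangle _ _).
    assert (Cmod (h z - h (RtoC 0)) < 1).
    { apply Hb. now replace (z - 0)%C with z by ring. }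
    unfold M; lra. }
  apply Cmod_eq_0, Rle_antisym; [|apply Cmod_ge_0].
  apply le_epsilon; intros eps He. rewrite Rplus_0_l.
  set (t := Rmin 1 (Rmin (d / (2 * L)) (eps / (2 * L * M)))).
  assert (Ht : 0 < t).
  { repeat apply Rmin_glb_lt; [lra| |]; apply Rdiv_lt_0_compat; nra. }
  assert (Ht1 : t <= 1) by apply Rmin_l.
  assert (Ht2 : t * L < d).
  { apply Rle_lt_trans with (d / (2 * L) * L).
    - apply Rmult_le_compat_r; [lra|].
      apply Rle_trans with (1 := Rmin_r _ _), Rmin_l.
    - replace (d / (2 * L) * L) with (d / 2) by (field; lra). lra. }
  assert (Ht3 : 2 * (t * L) * M <= eps).
  { apply Rle_trans with (2 * (eps / (2 * L * M) * L) * M).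
    - apply Rmult_le_compat_r; [lra|]. apply Rmult_le_compat_l; [lra|].
      apply Rmult_le_compat_r; [lra|].
      apply Rle_trans with (1 := Rmin_r _ _), Rmin_r.
    - right; field; lra. }
  assert (Hnz : forall u v, u <> 0 -> Rmin (t * u) u <= v <= Rmax (t * u) u -> v <> 0).
  { intros u v Hu. unfold Rmin, Rmax.
    destruct (Rle_dec (t * u) u); intros Hv ->; nra. }
  (* Only the rectangle with opposite corners 0 and [(t x, t y)] survives. *)
  rewrite (CIrect_split_hor h Hc 0 (t * x) x 0 y).
  rewrite (CIrect_split_ver h Hc 0 (t * x) 0 (t * y) y).
  rewrite (Goursat h (t * x) x 0 y Hc).
  2:{ intros x' y' H _. apply Hd. intros E. injection E; intros _ E1.
      now apply (Hnz x x'). }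
  rewrite (Goursat h 0 (t * x) (t * y) y Hc).
  2:{ intros x' y' _ H. apply Hd. intros E. injection E; intros E1 _.
      now apply (Hnz y y'). }
  rewrite !Cplus_0_r.
  apply Rle_trans with (2 := Ht3).
  replace (t * L) with (Rabs (t * x - 0) + Rabs (t * y - 0)).
  2:{ rewrite !Rminus_0_r, !Rabs_mult, (Rabs_pos_eq t) by lra. unfold L; ring. }
  apply CIrect_bound; [exact Hc|].
  intros x' y' Hx' Hy'. apply Hloc. apply Rle_lt_trans with (2 := Ht2).
  replace ((x', y') : C) with (RtoC x' + Ci * RtoC y')%C
    by (apply injective_projections; simpl; ring).
  apply Rle_trans with (1 := Cmod_triangle _ _).
  rewrite Cmod_mult, Cmod_Ci, !Cmod_R, Rmult_1_l.
  assert (B : forall u v, Rmin 0 (t * u) <= v <= Rmax 0 (t * u) -> Rabs v <= t * Rabs u).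
  { intros u v Hv. rewrite <- (Rabs_pos_eq t) by lra. rewrite <- Rabs_mult.
    revert Hv. unfold Rmin, Rmax. destruct (Rle_dec 0 (t * u)); intros Hv.
    - rewrite !Rabs_pos_eq; lra.
    - rewrite !Rabs_left1; lra. }
  unfold L. rewrite Rmult_plus_distr_l. apply Rplus_le_compat; now apply B.
Qed.

(** A function continuous on [C] and differentiable away from 0 has a primitive
    on [C], obtained by integrating from 0 along two sides of a rectangle.  Both
    ways of going round give the same value, and each of them yields one of the
    two partial derivatives. *)
Lemma primitive (h : C -> C) :
  (forall z, continuous h z) -> (forall z : C, z <> 0 -> Cdiff h z) ->
  exists H : C -> C, forall z, exists phi, slope H z phi /\ phi z = h z.
Proof.
  intros Hc Hd.
  set (H := fun z : C => (CIhor h 0 (fst z) 0 + CIver h (fst z) 0 (snd z))%C).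
  assert (H_alt : forall x y, H (x, y) = (CIver h 0 0 y + CIhor h 0 x y)%C).
  { intros x y. assert (E := CIrect_corner h x y Hc Hd). unfold CIrect in E.
    unfold H; simpl.
    rewrite <- (Cplus_0_r (CIver h 0 0 y + CIhor h 0 x y)), <- E. ring. }
  exists H. intros [x0 y0]. apply is_derive_slope, is_derive_C_eps.
  intros eps He.
  destruct (proj1 (continuous_C_eps h _) (Hc (x0, y0)) (eps / 2)) as [d [Hd0 Hb]];
    [lra|].
  exists (d / 2). split; [lra|]. intros [x y] Hz.
  set (k := h (x0, y0)) in *.
  assert (E : (H (x, y) - H (x0, y0) - ((x, y) - (x0, y0)) * k)%C =
     (CIver (fun z => h z - k) x y0 y + CIhor (fun z => h z - k) x0 x y0)%C).
  { replace (H (x, y) - H (x0, y0))%C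
      with ((H (x, y) - H (x, y0)) + (H (x, y0) - H (x0, y0)))%C by ring.
    assert (A1 : (CIver h x 0 y0 + CIver h x y0 y = CIver h x 0 y)%C)
      by now apply CInt_Chasles, continuous_ver.
    assert (A2 : (CIhor h 0 x0 y0 + CIhor h x0 x y0 = CIhor h 0 x y0)%C)
      by now apply (CInt_Chasles (fun x => h (x, y0))), continuous_hor.
    assert (E1 : CIver (fun z => h z - k)%C x y0 y =
       (CIver h x y0 y - RtoC (y - y0) * (Ci * k))%C).
    { rewrite <- CInt_const. unfold CIver. rewrite <- CInt_minus;
        [|now apply continuous_ver|intros; apply continuous_const].
      apply CInt_ext; intros; ring. }
    assert (E2 : CIhor (fun z => h z - k)%C x0 x y0 =
       (CIhor h x0 x y0 - RtoC (x - x0) * k)%C).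
    { rewrite <- CInt_const. unfold CIhor. rewrite <- CInt_minus;
        [reflexivity|now apply continuous_hor|intros; apply continuous_const]. }
    rewrite E1, E2.
    replace (H (x, y) - H (x, y0))%C with (CIver h x y0 y)
      by (unfold H; simpl fst; simpl snd; rewrite <- A1; ring).
    rewrite (H_alt x y0), (H_alt x0 y0), <- A2.
    replace ((x, y) - (x0, y0))%C with (RtoC (x - x0) + Ci * RtoC (y - y0))%C
      by (apply injective_projections; simpl; ring).
    ring. }
  assert (Hcm : forall z, continuous (fun z => h z - k)%C z).
  { intros z. apply continuous_Cminus; [apply Hc|apply continuous_const]. }
  assert (Hx : Rabs (x - x0) <= Cmod ((x, y) - (x0, y0))).
  { apply Rle_trans with (2 := Rmax_Cmod _), Rmax_l. }
  assert (Hy : Rabs (y - y0) <= Cmod ((x, y) - (x0, y0))).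
  { apply Rle_trans with (2 := Rmax_Cmod _), Rmax_r. }
  assert (Hin : forall u v, Rabs (u - x0) <= Rabs (x - x0) ->
     Rabs (v - y0) <= Rabs (y - y0) -> Cmod (h (u, v) - k) <= eps / 2).
  { intros u v Hu Hv. left. apply Hb.
    replace ((u, v) - (x0, y0))%C with (RtoC (u - x0) + Ci * RtoC (v - y0))%C
      by (apply injective_projections; simpl; ring).
    apply Rle_lt_trans with (1 := Cmod_triangle _ _).
    rewrite Cmod_mult, Cmod_Ci, !Cmod_R. lra. }
  assert (Hbet : forall u v t, Rmin u v <= t <= Rmax u v -> Rabs (t - u) <= Rabs (v - u)).
  { intros u v t. unfold Rmin, Rmax. destruct (Rle_dec u v); intros.
    - rewrite !Rabs_pos_eq; lra.
    - rewrite !Rabs_left1; lra. }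
  rewrite E. apply Rle_trans with (1 := Cmod_triangle _ _).
  apply Rle_trans with (Rabs (y - y0) * (eps / 2) + Rabs (x - x0) * (eps / 2)).
  - apply Rplus_le_compat.
    + apply CInt_bound; [now apply (continuous_ver (fun z => h z - k)%C)|].
      intros t Ht. rewrite Cmod_mult, Cmod_Ci, Rmult_1_l. apply Hin; [lra|].
      now apply Hbet.
    + apply CInt_bound; [now apply (continuous_hor (fun z => h z - k)%C)|].
      intros t Ht. apply Hin; [now apply Hbet|].
      rewrite Rminus_diag, Rabs_R0. apply Rabs_pos.
  - nra.
Qed.

Lemma Cdiff_shift (f : C -> C) (a z : C) : Cdiff f (z + a) -> Cdiff (fun w => f (w + a)%C) z.
Proof.
  intros H. apply (Cdiff_comp f (fun w => w + a)%C); [|exact H].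
  apply Cdiff_plus; [apply Cdiff_id|apply Cdiff_const].
Qed.

(** The difference quotient of an entire function is differentiable away from
    its base point. *)
Lemma quotient_Cdiff (f g : C -> C) (w z : C) :
  entire f -> (forall z, f z = f w + g z * (z - w))%C -> z <> w -> Cdiff g z.
Proof.
  intros Hf E Hz. rewrite entire_Cdiff in Hf.
  apply Cminus_neq_0 in Hz.
  apply Cdiff_ext_loc with (f := fun u => ((f u + - f w) * / (u + - w))%C)
    (d := Cmod (z - w)).
  - now apply Cmod_gt_0.
  - intros u Hu. rewrite (E u). field.
    intros Eu. change (u - w = 0)%C in Eu.
    replace (u - z)%C with ((u - w) - (z - w))%C in Hu by ring.
    rewrite Eu in Hu.
    replace (0 - (z - w))%C with (- (z - w))%C in Hu by ring.
    rewrite Cmod_opp in Hu. lra.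
  - apply Cdiff_mult.
    + apply Cdiff_plus; [apply Hf|apply Cdiff_const].
    + apply (Cdiff_comp Cinv (fun u => u + - w)%C).
      * apply Cdiff_plus; [apply Cdiff_id|apply Cdiff_const].
      * now apply Cdiff_inv.
Qed.

(** The difference quotient, extended by the derivative at its base point [w],
    has a primitive on the whole plane. *)
Lemma quotient_primitive (f : C -> C) (w : C) :
  entire f ->
  exists g H : C -> C, (forall z, f z = f w + g z * (z - w))%C /\
    (forall z, continuous g z) /\
    forall z, exists phi, slope H z phi /\ phi z = g z.
Proof.
  intros Hf. assert (Hf' := proj1 (entire_Cdiff f) Hf).
  destruct (Hf' w) as [g [Hg E]].
  assert (Hd : forall z, z <> w -> Cdiff g z)
    by (intros z; now apply quotient_Cdiff with f).
  assert (Hc : forall z, continuous g z).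
  { intros z. destruct (C_eq_dec z w) as [->|Hz]; [exact Hg|].
    now apply Cdiff_continuous, Hd. }
  destruct (primitive (fun z => g (z + w)%C)) as [H HH].
  - intros z. apply (continuous_comp (fun z => z + w)%C g); [|apply Hc].
    apply continuous_Cplus; [apply continuous_id|apply continuous_const].
  - intros z Hz. apply Cdiff_shift, Hd. intros Ew. apply Hz.
    replace z with ((z + w) - w)%C by ring. rewrite Ew; ring.
  - exists g, (fun z => H (z - w)%C). repeat split; trivial.
    intros z. destruct (HH (z - w)%C) as (phi & [Hphi Ephi] & Ez).
    exists (fun u => phi (u - w)%C). repeat split.
    + apply (continuous_comp (fun z => z - w)%C phi); [|exact Hphi].
      apply continuous_Cminus; [apply continuous_id|apply continuous_const].
    + intros u. rewrite Ephi. f_equal. ring.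
    + rewrite Ez. f_equal. ring.
Qed.

(** * Cauchy's formula *)

(** The circle of radius [r] about 0, parametrized by the angle. *)
Definition circle (r : R) (t : R) : C := (r * cos t, r * sin t).

Lemma Cmod_circle r t : 0 <= r -> Cmod (circle r t) = r.
Proof.
  intros Hr. unfold Cmod, circle; simpl fst; simpl snd.
  replace ((r * cos t) ^ 2 + (r * sin t) ^ 2) with (r ^ 2 * (sin t ^ 2 + cos t ^ 2)) by ring.
  assert (E := sin2_cos2 t). unfold Rsqr in E.
  replace (sin t ^ 2 + cos t ^ 2) with 1 by (rewrite <- E; ring).
  rewrite Rmult_1_r. now apply sqrt_pow2.
Qed.

Lemma is_derive_circle r t :
  @is_derive R_AbsRing C_R_NormedModule (circle r) t (Ci * circle r t)%C.
Proof.
  replace (Ci * circle r t)%C with ((r * - sin t, r * cos t) : C)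
    by (apply injective_projections; simpl; ring).
  apply (is_derive_pair (fun t => r * cos t) (fun t => r * sin t)); auto_derive; trivial; ring.
Qed.

Lemma continuous_circle r t : continuous (circle r) t.
Proof.
  apply (ex_derive_continuous (V := C_R_NormedModule) (circle r)).
  exists (Ci * circle r t)%C. apply is_derive_circle.
Qed.

Lemma circle_minus_neq_0 r t w : Cmod w < r -> (circle r t - w)%C <> 0.
Proof.
  intros Hw E. assert (E' : circle r t = w).
  { replace (circle r t) with ((circle r t - w) + w)%C by ring. rewrite E; ring. }
  assert (Hr : 0 <= r) by (generalize (Cmod_ge_0 w); lra).
  rewrite <- E', Cmod_circle in Hw; lra.
Qed.

Lemma Cmod_circle_minus r t w : Cmod w < r -> r - Cmod w <= Cmod (circle r t - w).
Proof.
  intros Hw. generalize (Cmod_ge_0 w) (Cmod_triangle (circle r t - w) w). intros.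
  replace (circle r t - w + w)%C with (circle r t) in * by ring.
  rewrite Cmod_circle in *; lra.
Qed.

Lemma continuous_Cauchy_kernel (F : R -> C) r w t :
  continuous F t -> Cmod w < r -> continuous (fun t => F t / (circle r t - w))%C t.
Proof.
  intros HF Hw. apply continuous_Cmult; [exact HF|].
  apply (continuous_Cinv (fun t => circle r t - w)%C).
  - apply continuous_Cminus; [apply continuous_circle|apply continuous_const].
  - now apply circle_minus_neq_0.
Qed.

(** An integral of Cauchy type, with an arbitrary density [F] in the angle. *)
Definition Cauchy_integral (F : R -> C) (r : R) (w : C) : C :=
  CInt (fun t => F t / (circle r t - w))%C 0 (2 * PI).

(** The integral of [dz / (z - w)] over the circle of radius [r].  It equals
    [2 i PI] when [Cmod w < r]; only its being nonzero for small [w] is used. *)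
Definition winding (r : R) (w : C) : C := Cauchy_integral (fun t => Ci * circle r t)%C r w.

(** Cauchy's formula, with the winding integral not evaluated: the difference
    quotient of [f] based at [w] has a primitive, so its integral over the
    circle vanishes. *)
Lemma Cauchy_formula (f : C -> C) (r : R) (w : C) :
  entire f -> Cmod w < r ->
  Cauchy_integral (fun t => Ci * circle r t * f (circle r t))%C r w = (f w * winding r w)%C.
Proof.
  intros Hf Hw.
  destruct (quotient_primitive f w Hf) as (g & H & E & Hc & HH).
  assert (Cf : forall t, continuous (fun t => f (circle r t)) t).
  { intros t. apply (continuous_comp (circle r) f); [apply continuous_circle|].
    apply Cdiff_continuous. now apply entire_Cdiff. }
  assert (C1 : forall t, continuous (fun t => Ci * circle r t)%C t).
  { intros t. apply continuous_Cmult; [apply continuous_const|apply continuous_circle]. }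
  unfold winding, Cauchy_integral.
  rewrite <- CInt_mult by (intros t; now apply continuous_Cauchy_kernel).
  assert (I0 : CInt (fun t => g (circle r t) * (Ci * circle r t))%C 0 (2 * PI) = 0).
  { rewrite (CInt_derive (fun t => H (circle r t))).
    - unfold circle. rewrite cos_2PI, sin_2PI, cos_0, sin_0. ring.
    - intros t. destruct (HH (circle r t)) as (phi & Hs & <-).
      apply is_derive_path; [exact Hs|apply is_derive_circle].
    - intros t. apply continuous_Cmult; [|apply C1].
      apply (continuous_comp (circle r) g); [apply continuous_circle|apply Hc]. }
  assert (D : forall u v : C, (u - v)%C = 0 -> u = v).
  { intros u v Euv. replace u with ((u - v) + v)%C by ring. rewrite Euv; ring. }
  apply D. rewrite <- CInt_minus.
  - rewrite <- I0. apply CInt_ext. intros t. rewrite (E (circle r t)).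
    field. now apply circle_minus_neq_0.
  - intros t. apply continuous_Cauchy_kernel; [|exact Hw]. now apply continuous_Cmult.
  - intros t. apply continuous_Cmult; [apply continuous_const|].
    now apply continuous_Cauchy_kernel.
Qed.

(** The winding integral differs from its value at [w = 0], which is [2 i PI],
    by less than [2 PI]. *)
Lemma winding_neq_0 r w : 2 * Cmod w < r -> winding r w <> 0.
Proof.
  intros Hr. assert (Hw0 := Cmod_ge_0 w).
  assert (Hw : Cmod w < r) by lra.
  assert (Hpi := PI_RGT_0).
  assert (C1 : forall t, continuous (fun t => Ci * circle r t)%C t).
  { intros t. apply continuous_Cmult; [apply continuous_const|apply continuous_circle]. }
  assert (B : Cmod (winding r w - RtoC (2 * PI - 0) * Ci)
     <= Rabs (2 * PI - 0) * (Cmod w / (r - Cmod w))).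
  { unfold winding, Cauchy_integral. rewrite <- CInt_const, <- CInt_minus.
    - apply CInt_bound.
      + intros t. apply continuous_Cminus; [|apply continuous_const].
        now apply continuous_Cauchy_kernel.
      + intros t _. assert (Hn := circle_minus_neq_0 r t w Hw).
        replace (Ci * circle r t / (circle r t - w) - Ci)%C
          with (Ci * w / (circle r t - w))%C by (field; exact Hn).
        rewrite Cmod_div, Cmod_mult, Cmod_Ci, Rmult_1_l by exact Hn.
        apply Rmult_le_compat_l; [exact Hw0|].
        apply Rinv_le_contravar; [lra|]. now apply Cmod_circle_minus.
    - intros t. now apply continuous_Cauchy_kernel.
    - intros; apply continuous_const. }
  intros E. rewrite E in B.
  unfold Cminus in B. rewrite Cplus_0_l, Cmod_opp, Cmod_mult, Cmod_Ci, Cmod_R in B.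
  rewrite Rminus_0_r, Rabs_pos_eq in B by lra.
  assert (Cmod w / (r - Cmod w) < 1) by (apply Rlt_div_l; lra).
  nra.
Qed.

Lemma continuous_C_bounded (F : R -> C) (a b : R) :
  (forall t, continuous F t) ->
  exists M, 0 < M /\ forall t, a <= t <= b -> Cmod (F t) <= M.
Proof.
  intros HF.
  destruct (bounded_continuity (V := C_R_NormedModule) F a b) as [M HM].
  - intros t _. apply HF.
  - exists (Rabs M + 1). split; [generalize (Rabs_pos M); lra|].
    intros t Ht. rewrite Cmod_norm. apply Rle_trans with M.
    + left; exact (HM t Ht).
    + generalize (Rle_abs M); lra.
Qed.

Lemma Cauchy_integral_Cdiff_0 (F : R -> C) (r : R) :
  0 < r -> (forall t, continuous F t) -> Cdiff (Cauchy_integral F r) 0.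
Proof.
  intros Hr HF.
  destruct (continuous_C_bounded F 0 (2 * PI) HF) as [M [HM HB]].
  assert (Hpi := PI_RGT_0).
  assert (H0 : Cmod 0 < r) by (rewrite Cmod_0; lra).
  set (l := CInt (fun t => F t / (circle r t - 0) / (circle r t - 0))%C 0 (2 * PI)).
  set (K := 2 * PI * (M * (2 / r / (r * r)))).
  assert (HK : 0 < K).
  { assert (0 < / r) by now apply Rinv_0_lt_compat.
    assert (0 < / (r * r)) by (apply Rinv_0_lt_compat; nra).
    assert (0 < M * (2 * / r * / (r * r))) by (apply Rmult_lt_0_compat; [lra|]; nra).
    unfold K, Rdiv. nra. }
  apply Cdiff_ex_derive. exists l. apply is_derive_C_eps. intros eps He.
  exists (Rmin (r / 2) (eps / K)). split.
  { apply Rmin_glb_lt; [lra|]. now apply Rdiv_lt_0_compat. }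
  intros w. replace (w - 0)%C with w by ring. intros Hw.
  assert (Hw1 : Cmod w < r / 2) by (apply Rlt_le_trans with (1 := Hw), Rmin_l).
  assert (Hw2 : Cmod w < eps / K) by (apply Rlt_le_trans with (1 := Hw), Rmin_r).
  assert (Hwr : Cmod w < r) by lra.
  assert (Hw0 := Cmod_ge_0 w).
  assert (Ck : forall v, Cmod v < r -> forall t,
     continuous (fun t => F t / (circle r t - v))%C t).
  { intros v Hv t. now apply continuous_Cauchy_kernel. }
  assert (Cl : forall t,
    continuous (fun t => F t / (circle r t - 0) / (circle r t - 0))%C t).
  { intros t. apply continuous_Cauchy_kernel; auto. }
  unfold l, Cauchy_integral.
  rewrite <- CInt_minus by auto.
  rewrite <- CInt_mult by auto.
  rewrite <- CInt_minus.
  2:{ intros t; apply continuous_Cminus; auto. }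
  2:{ intros t; apply continuous_Cmult; [apply continuous_const|auto]. }
  apply Rle_trans with (Rabs (2 * PI - 0) * (M * (2 / r / (r * r)) * (Cmod w * Cmod w))).
  - apply CInt_bound.
    + intros t. apply continuous_Cminus.
      * apply continuous_Cminus; auto.
      * apply continuous_Cmult; [apply continuous_const|auto].
    + intros t. rewrite Rmin_left, Rmax_right by lra. intros Ht.
      assert (Hn := circle_minus_neq_0 r t w Hwr).
      assert (Hn0 := circle_minus_neq_0 r t 0 H0).
      replace (F t / (circle r t - w) - F t / (circle r t - 0) -
        w * (F t / (circle r t - 0) / (circle r t - 0)))%C
        with (F t * (/ (circle r t - w) * / (circle r t - 0) * / (circle r t - 0))
              * (w * w))%C.
      2:{ replace w with ((circle r t - 0) - (circle r t - w))%C at 2 3 5 by ring.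
          generalize dependent (circle r t - w)%C.
          generalize dependent (circle r t - 0)%C.
          intros p Hp q Hq. field; now split. }
      rewrite !Cmod_mult, !Cmod_inv by assumption.
      assert (B1 := Cmod_circle_minus r t w Hwr).
      replace (Cmod (circle r t - 0)) with r
        by (replace (circle r t - 0)%C with (circle r t) by ring;
            rewrite Cmod_circle; lra).
      apply Rmult_le_compat_r; [nra|].
      assert (B2 : / Cmod (circle r t - w) <= 2 / r).
      { replace (2 / r) with (/ (r / 2)) by (field; lra).
        apply Rinv_le_contravar; lra. }
      assert (0 < / r) by now apply Rinv_0_lt_compat.
      apply Rmult_le_compat.
      * apply Cmod_ge_0.
      * repeat apply Rmult_le_pos; try lra. left; apply Rinv_0_lt_compat; lra.
      * now apply HB.
      * unfold Rdiv at 1. rewrite Rinv_mult, Rmult_assoc.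
        apply Rmult_le_compat_r; [nra|exact B2].
  - rewrite Rminus_0_r, Rabs_pos_eq by lra.
    replace (2 * PI * (M * (2 / r / (r * r)) * (Cmod w * Cmod w)))
      with (K * Cmod w * Cmod w) by (unfold K; ring).
    apply Rmult_le_compat_r; [exact Hw0|].
    apply Rlt_div_r in Hw2; [|exact HK]. lra.
Qed.

(** * Zeros of entire functions *)

(** Removable singularity at 0.  Near 0 the quotient [f z / z] is a ratio of two
    integrals of Cauchy type, both differentiable at 0. *)
Lemma removable_0 (f : C -> C) :
  entire f -> f 0 = 0 -> exists g, entire g /\ forall z, f z = (z * g z)%C.
Proof.
  intros Hf f0.
  set (F := fun t => (Ci * f (circle 1 t))%C).
  set (k := fun w => (Cauchy_integral F 1 w * / winding 1 w)%C).
  set (g := fun w => if C_eq_dec w 0 then k w else (f w / w)%C).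
  assert (Cf : forall t, continuous (fun t => f (circle 1 t)) t).
  { intros t. apply (continuous_comp (circle 1) f); [apply continuous_circle|].
    apply Cdiff_continuous. now apply entire_Cdiff. }
  assert (CF : forall t, continuous F t).
  { intros t. apply continuous_Cmult; [apply continuous_const|apply Cf]. }
  assert (C1 : forall t, continuous (fun t => Ci * circle 1 t)%C t).
  { intros t. apply continuous_Cmult; [apply continuous_const|apply continuous_circle]. }
  assert (Ef : forall z, f z = (z * g z)%C).
  { intros z. unfold g. destruct (C_eq_dec z 0) as [->|Hz]; [rewrite f0; ring|].
    field; exact Hz. }
  exists g. split; [|exact Ef].
  apply entire_Cdiff. intros z. destruct (C_eq_dec z 0) as [->|Hz].
  2:{ apply quotient_Cdiff with f (RtoC 0); trivial. intros u. rewrite f0, (Ef u). ring. }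
  apply Cdiff_ext_loc with (f := k) (d := / 2); [lra| |].
  - intros w. replace (w - 0)%C with w by ring. intros Hw.
    unfold g. destruct (C_eq_dec w 0) as [->|Hw0]; [reflexivity|].
    assert (Hw1 : Cmod w < 1) by lra.
    assert (H0 : Cmod 0 < 1) by (rewrite Cmod_0; lra).
    assert (N := winding_neq_0 1 w ltac:(lra)).
    assert (E : (f w * winding 1 w)%C = (w * Cauchy_integral F 1 w)%C).
    { rewrite <- (Cauchy_formula f 1 w Hf Hw1).
      assert (E0 : Cauchy_integral (fun t => Ci * circle 1 t * f (circle 1 t))%C 1 0 = 0).
      { rewrite Cauchy_formula, f0 by trivial. ring. }
      replace (Cauchy_integral (fun t => Ci * circle 1 t * f (circle 1 t))%C 1 w)
        with (Cauchy_integral (fun t => Ci * circle 1 t * f (circle 1 t))%C 1 w -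
          Cauchy_integral (fun t => Ci * circle 1 t * f (circle 1 t))%C 1 0)%C
        by (rewrite E0; ring).
      unfold Cauchy_integral.
      rewrite <- CInt_mult by (intros; now apply continuous_Cauchy_kernel).
      rewrite <- CInt_minus
        by (intros; apply continuous_Cauchy_kernel; trivial; now apply continuous_Cmult).
      apply CInt_ext. intros t. unfold F.
      assert (Hn := circle_minus_neq_0 1 t w Hw1).
      assert (Hn0 := circle_minus_neq_0 1 t 0 H0).
      replace (circle 1 t - 0)%C with (circle 1 t) in * by ring.
      field. now split. }
    unfold k. replace (Cauchy_integral F 1 w) with (f w * winding 1 w / w)%C
      by (rewrite E; field; exact Hw0).
    field; now split.
  - apply Cdiff_mult; [apply Cauchy_integral_Cdiff_0; [lra|exact CF]|].
    apply (Cdiff_comp Cinv (winding 1)).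
    + exact (Cauchy_integral_Cdiff_0 (fun t => Ci * circle 1 t)%C 1 Rlt_0_1 C1).
    + apply Cdiff_inv, winding_neq_0. rewrite Cmod_0; lra.
Qed.

(** Identity theorem.  If [f z = z ^ k g z], Cauchy's formula for [g] on a circle
    of radius [r > 2 |w|] gives [|f w| = O((|w| / r) ^ k)], for every [k]. *)
Lemma flat_zero (f : C -> C) :
  entire f -> (forall k, exists g, entire g /\ forall z, f z = (z ^ k * g z)%C) ->
  forall w, f w = 0.
Proof.
  intros Hf H w. set (r := 2 * Cmod w + 1).
  assert (Hw0 := Cmod_ge_0 w).
  assert (Hw : Cmod w < r) by (unfold r; lra).
  assert (Hr : 0 < r) by lra.
  assert (Hpi := PI_RGT_0).
  assert (N := winding_neq_0 r w ltac:(unfold r; lra)).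
  assert (HN : 0 < Cmod (winding r w)) by now apply Cmod_gt_0.
  destruct (continuous_C_bounded (fun t => f (circle r t)) 0 (2 * PI)) as [M [HM HB]].
  { intros t. apply (continuous_comp (circle r) f); [apply continuous_circle|].
    apply Cdiff_continuous. now apply entire_Cdiff. }
  set (K := 2 * PI * (r * M / (r - Cmod w))).
  assert (HK : 0 < K).
  { unfold K. apply Rmult_lt_0_compat; [lra|]. apply Rdiv_lt_0_compat; nra. }
  assert (B : forall k, Cmod (f w) * Cmod (winding r w) <= K * (/ 2) ^ k).
  { intros k. destruct (H k) as (g & Hg & E).
    assert (Hrk : 0 < r ^ k) by now apply pow_lt.
    assert (Bg : Cmod (g w * winding r w) <= K * / r ^ k).
    { rewrite <- (Cauchy_formula g r w Hg Hw). unfold K.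
      replace (2 * PI * (r * M / (r - Cmod w)) * / r ^ k)
        with (Rabs (2 * PI - 0) * (r * (M * / r ^ k) * / (r - Cmod w)))
        by (rewrite Rminus_0_r, Rabs_pos_eq by lra; field; lra).
      apply CInt_bound.
      - intros t. apply continuous_Cauchy_kernel; [|exact Hw].
        apply continuous_Cmult.
        + apply continuous_Cmult; [apply continuous_const|apply continuous_circle].
        + apply (continuous_comp (circle r) g); [apply continuous_circle|].
          apply Cdiff_continuous. now apply entire_Cdiff.
      - intros t. rewrite Rmin_left, Rmax_right by lra. intros Ht.
        assert (Hn := circle_minus_neq_0 r t w Hw).
        rewrite Cmod_div, !Cmod_mult, Cmod_Ci, Rmult_1_l, Cmod_circle by (trivial; lra).
        assert (Bc := Cmod_circle_minus r t w Hw).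
        apply Rmult_le_compat.
        + apply Rmult_le_pos; [lra|apply Cmod_ge_0].
        + left; apply Rinv_0_lt_compat; lra.
        + apply Rmult_le_compat_l; [lra|].
          assert (Bf := HB t Ht). simpl in Bf.
          rewrite E, Cmod_mult, Cmod_pow, Cmod_circle in Bf by lra.
          apply Rle_div_r; [exact Hrk|]. lra.
        + apply Rinv_le_contravar; lra. }
    rewrite <- Cmod_mult, (E w), <- Cmult_assoc, Cmod_mult, Cmod_pow.
    apply Rle_trans with (Cmod w ^ k * (K * / r ^ k)).
    - apply Rmult_le_compat_l; [now apply pow_le|exact Bg].
    - replace (Cmod w ^ k * (K * / r ^ k)) with (K * (Cmod w * / r) ^ k)
        by (rewrite Rpow_mult_distr, pow_inv; ring).
      apply Rmult_le_compat_l; [lra|]. apply pow_incr. split.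
      + apply Rmult_le_pos; [lra|]. left; now apply Rinv_0_lt_compat.
      + apply Rle_div_l; [exact Hr|]. unfold r; lra. }
  apply Cmod_eq_0. apply Rle_antisym; [|apply Cmod_ge_0].
  apply Rnot_lt_le. intros Hlt.
  assert (Hp : 0 < Cmod (f w) * Cmod (winding r w)) by nra.
  destruct (pow_lt_1_zero (/ 2)) with (y := Cmod (f w) * Cmod (winding r w) / K)
    as [n Hn].
  - rewrite Rabs_pos_eq; lra.
  - now apply Rdiv_lt_0_compat.
  - specialize (Hn n (le_n n)). specialize (B n).
    rewrite Rabs_pos_eq in Hn by (apply pow_le; lra).
    apply Rlt_div_r in Hn; [|exact HK]. lra.
Qed.

Lemma entire_shift (f : C -> C) (a : C) : entire f -> entire (fun z => f (z + a)%C).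
Proof.
  rewrite !entire_Cdiff. intros H z. apply Cdiff_shift, H.
Qed.

(** The factor theorem for entire functions. *)
Lemma removable (f : C -> C) (a : C) :
  entire f -> f a = 0 -> exists g, entire g /\ forall z, f z = ((z - a) * g z)%C.
Proof.
  intros Hf fa.
  destruct (removable_0 (fun z => f (z + a)%C)) as (g & Hg & E).
  - now apply entire_shift.
  - now rewrite Cplus_0_l.
  - exists (fun z => g (z + - a)%C). split; [now apply entire_shift|].
    intros z. rewrite <- E. f_equal. ring.
Qed.

(** A nonzero entire function vanishes to a finite order [k] at [a]; the case
    [k = 0], that is [f a <> 0], is included. *)
Lemma finite_order (f : C -> C) (a : C) :
  entire f -> (exists z, f z <> 0) ->
  exists k u, entire u /\ u a <> 0 /\ forall z, f z = ((z - a) ^ k * u z)%C.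
Proof.
  intros Hf [w Hw].
  apply NNPP. intros Hno. apply Hw.
  assert (Hk : forall k, exists g, entire g /\ forall z, f z = ((z - a) ^ k * g z)%C).
  { induction k as [|k (g & Hg & E)].
    - exists f. split; [exact Hf|]. intros; simpl; ring.
    - destruct (C_eq_dec (g a) 0) as [Ha|Ha].
      + destruct (removable g a Hg Ha) as (g' & Hg' & E').
        exists g'. split; [exact Hg'|]. intros z. rewrite E, E'. simpl. ring.
      + exfalso. apply Hno. now exists k, g. }
  replace w with ((w - a) + a)%C by ring.
  apply (flat_zero (fun z => f (z + a)%C)); [now apply entire_shift|].
  intros k. destruct (Hk k) as (g & Hg & E).
  exists (fun z => g (z + a)%C). split; [now apply entire_shift|].
  intros z. rewrite E. do 2 f_equal. ring.
Qed.

(** * The complex exponential *)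

(** Its value at [x + i y] is [exp x * (cos y + i sin y)]. *)
Definition cexp (z : C) : C := (exp (fst z) * cos (snd z), exp (fst z) * sin (snd z)).

Lemma cexp_plus z w : cexp (z + w) = (cexp z * cexp w)%C.
Proof.
  unfold cexp; apply injective_projections; simpl;
    rewrite exp_plus, ?cos_plus, ?sin_plus; ring.
Qed.

Lemma cexp_0 : cexp 0 = 1.
Proof.
  unfold cexp; simpl. rewrite exp_0, cos_0, sin_0.
  apply injective_projections; simpl; ring.
Qed.

Lemma cexp_neq_0 z : cexp z <> 0.
Proof.
  intros E. assert (H := cexp_plus z (- z)).
  rewrite E, Cplus_opp_r, cexp_0, Cmult_0_l in H.
  injection H; lra.
Qed.

Lemma cexp_RtoC x : cexp (RtoC x) = RtoC (exp x).
Proof.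
  unfold cexp; simpl. rewrite cos_0, sin_0.
  apply injective_projections; simpl; ring.
Qed.

Lemma derivable_pt_lim_0_eps (f : R -> R) (l : R) :
  derivable_pt_lim f 0 l -> forall eps, 0 < eps -> exists d, 0 < d /\
    forall x, Rabs x < d -> Rabs (f x - f 0 - x * l) <= eps * Rabs x.
Proof.
  intros H eps He. destruct (H eps He) as [d Hd].
  exists d; split; [apply cond_pos|]. intros x Hx.
  destruct (Req_dec x 0) as [->|Hn].
  - rewrite Rmult_0_l, Rminus_0_r, Rminus_diag, Rabs_R0. lra.
  - specialize (Hd x Hn Hx). rewrite Rplus_0_l in Hd.
    replace (f x - f 0 - x * l) with (((f x - f 0) / x - l) * x) by (field; exact Hn).
    rewrite Rabs_mult. apply Rmult_le_compat_r; [apply Rabs_pos|lra].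
Qed.

Lemma Cdiff_cexp_0 : Cdiff cexp 0.
Proof.
  apply Cdiff_ex_derive. exists (RtoC 1). apply is_derive_C_eps. intros eps He.
  set (e := Rmin 1 (eps / 10)).
  assert (He0 : 0 < e) by (apply Rmin_glb_lt; lra).
  assert (He1 : e <= 1) by apply Rmin_l.
  assert (He2 : e <= eps / 10) by apply Rmin_r.
  destruct (derivable_pt_lim_0_eps exp 1) with (eps := e) as [d1 [Hd1 B1]]; trivial.
  { rewrite <- exp_0. apply derivable_pt_lim_exp. }
  destruct (derivable_pt_lim_0_eps cos 0) with (eps := e) as [d2 [Hd2 B2]]; trivial.
  { replace 0 with (- sin 0) at 2 by (rewrite sin_0; ring). apply derivable_pt_lim_cos. }
  destruct (derivable_pt_lim_0_eps sin 1) with (eps := e) as [d3 [Hd3 B3]]; trivial.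
  { rewrite <- cos_0. apply derivable_pt_lim_sin. }
  exists (Rmin (Rmin d1 d2) (Rmin d3 (e / 2))). split.
  { repeat apply Rmin_glb_lt; lra. }
  intros [x y]. replace ((x, y) - 0)%C with ((x, y) : C)
    by (apply injective_projections; simpl; ring).
  intros Hz.
  assert (Hx : Rabs x <= Cmod (x, y)).
  { apply Rle_trans with (2 := Rmax_Cmod (x, y)), Rmax_l. }
  assert (Hy : Rabs y <= Cmod (x, y)).
  { apply Rle_trans with (2 := Rmax_Cmod (x, y)), Rmax_r. }
  generalize (Rmin_l (Rmin d1 d2) (Rmin d3 (e / 2))) (Rmin_r (Rmin d1 d2) (Rmin d3 (e / 2)))
    (Rmin_l d1 d2) (Rmin_r d1 d2) (Rmin_l d3 (e / 2)) (Rmin_r d3 (e / 2)); intros.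
  specialize (B1 x ltac:(lra)). specialize (B2 y ltac:(lra)). specialize (B3 y ltac:(lra)).
  rewrite exp_0 in B1. rewrite cos_0 in B2. rewrite sin_0 in B3.
  rewrite cexp_0.
  set (m := Cmod (x, y)) in *.
  set (p := exp x - 1 - x * 1) in *. set (c := cos y - 1 - y * 0) in *.
  set (s := sin y - 0 - y * 1) in *.
  assert (Hm : 0 <= m) by apply Cmod_ge_0.
  replace (cexp (x, y) - 1 - (x, y) * 1)%C
    with (RtoC (exp x) * (RtoC c + Ci * RtoC s) + RtoC p + RtoC (p + x) * (Ci * RtoC y))%C
    by (unfold cexp, c, s, p; apply injective_projections; simpl; ring).
  assert (Hp0 : Rabs (p + x) <= 2 * Rabs x).
  { apply Rle_trans with (1 := Rabs_triang _ _). generalize (Rabs_pos x). nra. }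
  assert (Hexp : Rabs (exp x) <= 2).
  { replace (exp x) with ((p + x) + 1) by (unfold p; ring).
    apply Rle_trans with (1 := Rabs_triang _ _). rewrite Rabs_R1. lra. }
  assert (K1 : Cmod (RtoC (exp x) * (RtoC c + Ci * RtoC s)) <= 2 * (2 * (e * m))).
  { rewrite Cmod_mult, Cmod_R.
    apply Rmult_le_compat; [apply Rabs_pos|apply Cmod_ge_0|exact Hexp|].
    apply Rle_trans with (1 := Cmod_triangle _ _).
    rewrite Cmod_mult, Cmod_Ci, !Cmod_R. nra. }
  assert (K2 : Cmod (RtoC p) <= e * m) by (rewrite Cmod_R; nra).
  assert (K3 : Cmod (RtoC (p + x) * (Ci * RtoC y)) <= e * m).
  { rewrite !Cmod_mult, Cmod_Ci, !Cmod_R, Rmult_1_l.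
    apply Rmult_le_compat; try apply Rabs_pos; lra. }
  apply Rle_trans with (1 := Cmod_triangle _ _).
  apply Rle_trans with (2 * (2 * (e * m)) + e * m + e * m); [|nra].
  apply Rplus_le_compat; [|exact K3].
  apply Rle_trans with (1 := Cmod_triangle _ _). lra.
Qed.

Lemma entire_cexp : entire cexp.
Proof.
  apply entire_Cdiff. intros z.
  apply Cdiff_ext with (f := fun w => (cexp z * cexp (w + - z))%C).
  - intros w. rewrite <- cexp_plus. f_equal. ring.
  - apply Cdiff_mult; [apply Cdiff_const|].
    apply Cdiff_shift. rewrite Cplus_opp_r. apply Cdiff_cexp_0.
Qed.

(** * Entire functions with prescribed values at the integers *)

Lemma entire_comp f g : entire f -> entire g -> entire (fun z => f (g z)).
Proof. rewrite !entire_Cdiff. intros Hf Hg z. now apply Cdiff_comp. Qed.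

Lemma entire_id : entire (fun z => z).
Proof. apply entire_Cdiff, Cdiff_id. Qed.

Lemma entire_inv f : entire f -> (forall z, f z <> 0) -> entire (fun z => / f z)%C.
Proof.
  rewrite !entire_Cdiff. intros Hf Hn z.
  apply Cdiff_comp; [apply Hf|apply Cdiff_inv, Hn].
Qed.

Lemma entire_pow f n : entire f -> entire (fun z => f z ^ n)%C.
Proof.
  intros Hf. induction n as [|n IH].
  - exact (entire_const 1).
  - exact (entire_mult f _ Hf IH).
Qed.

Lemma ZtoC_inj m n : ZtoC m = ZtoC n -> m = n.
Proof. intros E. apply eq_IZR. now injection E. Qed.

Lemma ZtoC_mult m n : ZtoC (m * n) = (ZtoC m * ZtoC n)%C.
Proof. unfold ZtoC. now rewrite mult_IZR, RtoC_mult. Qed.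

(** An entire function that vanishes at all integers other than [a] but not at
    [a]: divide [exp (2 i PI z) - 1] by the largest possible power of [z - a]. *)
Lemma sampling (a : C) :
  exists v : C -> C, entire v /\ v a <> 0 /\ forall n, ZtoC n <> a -> v (ZtoC n) = 0.
Proof.
  set (E := fun z => (cexp (Ci * RtoC (2 * PI) * z) + - (1))%C).
  assert (HE : entire E).
  { apply entire_plus; [|apply entire_const].
    apply (entire_comp cexp (fun z => Ci * RtoC (2 * PI) * z)%C entire_cexp).
    apply entire_mult; [apply entire_const|apply entire_id]. }
  assert (E0 : forall n, E (ZtoC n) = 0).
  { intros n. unfold E, ZtoC.
    replace (Ci * RtoC (2 * PI) * RtoC (IZR n))%C with ((0, 2 * (IZR n * PI)) : C)
      by (apply injective_projections; simpl; ring).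
    unfold cexp; simpl fst; simpl snd. rewrite exp_0, cos_2a_sin, sin_2a.
    rewrite (sin_eq_0_1 (IZR n * PI)) by now exists n.
    apply injective_projections; simpl; ring. }
  assert (E1 : E (RtoC (/ 2)) <> 0).
  { unfold E.
    replace (Ci * RtoC (2 * PI) * RtoC (/ 2))%C with ((0, PI) : C)
      by (apply injective_projections; simpl; field).
    unfold cexp; simpl fst; simpl snd. rewrite exp_0, cos_PI, sin_PI.
    intros H. injection H; lra. }
  destruct (finite_order E a HE) as (k & u & Hu & Hua & Ek); [now exists (RtoC (/ 2))|].
  exists u. repeat split; trivial.
  intros n Hn. assert (H := E0 n). rewrite Ek in H.
  assert (Hd : ((ZtoC n - a) ^ k)%C <> 0) by now apply Cpow_nz, Cminus_neq_0.
  replace (u (ZtoC n)) with (/ (ZtoC n - a) ^ k * ((ZtoC n - a) ^ k * u (ZtoC n)))%C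
    by (field; exact Hd).
  rewrite H. ring.
Qed.

(** A nowhere vanishing entire function with value [p] at [n] and 1 at every other
    integer. *)
Lemma prime_at (n p : Z) : (0 < p)%Z ->
  exists e : C -> C, entire e /\ (forall z, e z <> 0) /\ e (ZtoC n) = ZtoC p /\
    forall m, m <> n -> e (ZtoC m) = 1.
Proof.
  intros Hp. destruct (sampling (ZtoC n)) as (v & Hv & Hn & H0).
  exists (fun z => cexp (RtoC (ln (IZR p)) * / v (ZtoC n) * v z)%C). repeat split.
  - apply (entire_comp cexp _ entire_cexp).
    apply entire_mult; [apply entire_const|exact Hv].
  - intros z. apply cexp_neq_0.
  - replace (RtoC (ln (IZR p)) * / v (ZtoC n) * v (ZtoC n))%C with (RtoC (ln (IZR p)))
      by (field; exact Hn).
    rewrite cexp_RtoC, exp_ln; [reflexivity|]. now apply IZR_lt.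
  - intros m Hm. rewrite (H0 m), Cmult_0_r; [apply cexp_0|].
    intros E. now apply Hm, ZtoC_inj.
Qed.

(** * Prime ideals of integer-valued entire functions *)

(** Powers in the ring of integer-valued entire functions. *)
Definition IVE_pow (f : IVE) (n : nat) : IVE := Nat.iter n (mult f) one.

Lemma IVE_pow_apply (f : IVE) (n : nat) (z : C) : IVE_pow f n z = (f z ^ n)%C.
Proof.
  induction n as [|n IH]; [reflexivity|].
  change (f z * IVE_pow f n z = f z ^ S n)%C. now rewrite IH.
Qed.

Lemma prime_ideal_pow (P : IVE -> Prop) (f : IVE) (n : nat) :
  prime_ideal P -> P (IVE_pow f n) -> P f.
Proof.
  intros (_ & H1 & Hm). induction n as [|n IH]; intros H; [now elim H1|].
  destruct (Hm f (IVE_pow f n) H); auto.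
Qed.

(** A nonzero prime ideal of functions vanishing at [a] contains all of them.
    Write a nonzero member as [f0 = (z - a) ^ k u] with [u a <> 0], and
    [f = (z - a) g].  For every [s],
    [f ^ (k + 1) * (u s) = ((z - a) g ^ (k + 1) s) * f0].
    With [s] equal to [(z - a) ^ k] at the integers other than [a] and to
    [1 / u a] at [a], both [u s] and [(z - a) g ^ (k + 1) s] are integer-valued,
    and [u s], not vanishing at [a], lies outside [P]. *)
Lemma prime_ideal_of_zero (P : IVE -> Prop) (a : C) :
  prime_ideal P -> (exists f, P f /\ f <> zero) -> (forall f, P f -> f a = 0) ->
  forall f : IVE, f a = 0 -> P f.
Proof.
  intros HP (f0 & Pf0 & nf0) Ha f fa.
  assert (E0 := Ha f0 Pf0).
  destruct (finite_order f0 a (IVE_entire f0)) as (k & u & Hu & Hua & Eu).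
  { apply NNPP. intros H. apply nf0, IVE_ext. intros z.
    change (f0 z = 0). apply NNPP. intros Hz. apply H. now exists z. }
  assert (Hk : k <> O).
  { intros ->. apply Hua. rewrite <- E0, Eu. simpl. ring. }
  assert (Zk : ((a - a) ^ k)%C = 0).
  { destruct k; [now elim Hk|]. simpl. ring. }
  destruct (removable f a (IVE_entire f) fa) as (g & Hg & Eg).
  destruct (sampling a) as (v & Hv & Hva & Hvn).
  set (s := fun z => ((z + - a) ^ k + / (u a * v a) * v z)%C).
  assert (Hs : entire s).
  { apply entire_plus.
    - apply (entire_pow (fun z => z + - a)%C).
      apply entire_plus; [apply entire_id|apply entire_const].
    - apply entire_mult; [apply entire_const|exact Hv]. }
  assert (Esn : forall n, ZtoC n <> a -> s (ZtoC n) = ((ZtoC n - a) ^ k)%C).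
  { intros n Hn. unfold s. rewrite Hvn by exact Hn. unfold Cminus. ring. }
  assert (Exa : (u a * s a)%C = 1).
  { unfold s. change (a + - a)%C with (a - a)%C. rewrite Zk. field. now split. }
  assert (Hx : forall n, exists m, (u (ZtoC n) * s (ZtoC n))%C = ZtoC m).
  { intros n. destruct (C_eq_dec (ZtoC n) a) as [->|Hn].
    - exists 1%Z. exact Exa.
    - destruct (IVE_int f0 n) as [m Em]. exists m.
      rewrite <- Em, Eu, Esn by exact Hn. ring. }
  set (x := mkIVE _ (entire_mult u s Hu Hs) Hx).
  assert (Hy' : entire (fun z => (z + - a) * g z ^ S k * s z)%C).
  { apply entire_mult; [|exact Hs]. apply entire_mult; [|now apply entire_pow].
    apply entire_plus; [apply entire_id|apply entire_const]. }
  assert (Hy : forall n, exists m,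
    ((ZtoC n + - a) * g (ZtoC n) ^ S k * s (ZtoC n))%C = ZtoC m).
  { intros n. destruct (C_eq_dec (ZtoC n) a) as [->|Hn].
    - exists 0%Z. rewrite Cplus_opp_r. unfold ZtoC. ring.
    - destruct (IVE_int (IVE_pow f (S k)) n) as [m Em]. exists m.
      rewrite <- Em, IVE_pow_apply, Eg, Esn by exact Hn.
      rewrite Cpow_mult_l. simpl. unfold Cminus. ring. }
  set (y := mkIVE _ Hy' Hy).
  assert (Exy : mult (IVE_pow f (S k)) x = mult y f0).
  { apply IVE_ext. intros z.
    change (IVE_pow f (S k) z * (u z * s z) =
       (z + - a) * g z ^ S k * s z * f0 z)%C.
    rewrite IVE_pow_apply, Eg, Eu, Cpow_mult_l. simpl. unfold Cminus. ring. }
  assert (Px : ~ P x).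
  { intros H. apply Ha in H. change (u a * s a = 0)%C in H. rewrite Exa in H.
    injection H; lra. }
  destruct HP as ((HP1 & HP2 & HP3) & HP4 & HP5).
  destruct (HP5 (IVE_pow f (S k)) x) as [H|H].
  - rewrite Exy. now apply HP3.
  - now apply prime_ideal_pow with (S k).
  - now elim Px.
Qed.

Lemma prime_divisor (m : Z) : (1 < m)%Z -> exists p, prime p /\ (p | m)%Z.
Proof.
  intros Hm. assert (H0 : (0 <= m)%Z) by lia. revert Hm.
  pattern m. apply Zlt_0_ind; [|exact H0]. clear m H0. intros m IH _ Hm.
  destruct (prime_dec m) as [Hp|Hp]; [exists m; split; [exact Hp|apply Z.divide_refl]|].
  destruct (not_prime_divide m Hm Hp) as (d & Hd & Hdm).
  destruct (IH d) as (p & Hp' & Hpd); [lia|lia|].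
  exists p; split; [exact Hp'|]. now apply Z.divide_trans with d.
Qed.

(** A nowhere vanishing element with values [1] and [-1] at the integers is a unit. *)
Lemma unit_of_values (q : IVE) :
  (forall z, q z <> 0) ->
  (forall n m, q (ZtoC n) = ZtoC m -> Z.abs m = 1%Z) -> is_unit q.
Proof.
  intros Hq H.
  assert (Hi : forall n, exists m, (/ q (ZtoC n))%C = ZtoC m).
  { intros n. destruct (IVE_int q n) as [m Em]. exists m. rewrite Em.
    specialize (H n m Em). unfold ZtoC.
    assert (Hm : m = 1%Z \/ m = (-1)%Z) by lia.
    rewrite <- RtoC_inv by (destruct Hm as [-> | ->]; lra).
    f_equal. destruct Hm as [-> | ->]; field. }
  exists (mkIVE _ (entire_inv q (IVE_entire q) Hq) Hi).
  apply IVE_ext. intros z. change (q z * / q z = 1)%C. apply Cinv_r, Hq.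
Qed.

Theorem theorem3p5
  (P : IVE -> Prop)
  (P_prime : prime_ideal P)
  (P_nonzero : exists f : IVE, P f /\ f <> zero)
  (P_irr : nonempty (intersection P irreducible_divisors)) :
  (nonempty (intersection P zeros) ->
     exists a : C, forall f : IVE, P f <-> f a = RtoC 0) /\
  (~ nonempty (intersection P zeros) ->
     exists n p : Z, prime p /\
       forall f : IVE, P f <-> value_divisible p n f).
Proof.
  split.
  - intros [[a k] Ha]. exists a.
    assert (Hz : forall f, P f -> f a = 0).
    { intros f Pf. destruct (Ha f Pf) as (Hk & g & _ & E). simpl in Hk, E.
      rewrite E. destruct k; [lia|]. simpl. ring. }
    intros f; split; [apply Hz|]. now apply prime_ideal_of_zero.
  - intros HZ. destruct P_irr as [q Hq].
    (* If all of [P] vanished at [a], the factor theorem would make [a] a common zero. *)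
    assert (Hnz : forall a, exists f, P f /\ f a <> 0).
    { intros a. apply NNPP. intros H. apply HZ. exists (a, 1%nat).
      intros f Pf. split; [simpl; lia|].
      destruct (removable f a (IVE_entire f)) as (g & Hg & E).
      - apply NNPP. intros Hfa. apply H. now exists f.
      - exists g. split; [exact Hg|]. intros z. rewrite E. simpl. ring. }
    assert (Hdiv : forall f, P f -> divides q f) by (intros f Pf; apply (Hq f Pf)).
    assert (Hirr : irreducible q).
    { destruct P_nonzero as (f & Pf & _). apply (Hq f Pf). }
    assert (q_nz : forall a, q a <> 0).
    { intros a Hqa. destruct (Hnz a) as (f & Pf & Hfa).
      destruct (Hdiv f Pf) as [h ->]. apply Hfa.
      change (q a * h a = 0)%C. rewrite Hqa. ring. }
    destruct Hirr as (_ & q_nu & _).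
    assert (Hval : exists n m, q (ZtoC n) = ZtoC m /\ Z.abs m <> 1%Z).
    { apply NNPP. intros H. apply q_nu, unit_of_values; [exact q_nz|].
      intros n m E. apply NNPP. intros Hm. apply H. now exists n, m. }
    destruct Hval as (n & m & Em & Hm1).
    assert (Hm0 : m <> 0%Z).
    { intros ->. now apply (q_nz (ZtoC n)). }
    destruct (prime_divisor (Z.abs m)) as (p & Hp & Hpm); [lia|].
    rewrite Z.divide_abs_r in Hpm.
    assert (Hp1 : (1 < p)%Z) by (destruct Hp; lia).
    destruct (prime_at n p) as (e & He & e_nz & e_n & e_m); [lia|].
    assert (Hei : forall k, exists l, e (ZtoC k) = ZtoC l).
    { intros k. destruct (Z.eq_dec k n) as [->|Hk]; [now exists p|].
      exists 1%Z. now rewrite e_m. }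
    set (E := mkIVE e He Hei).
    (* [E] has no zeros; among the values at the integers, dividing by [E] changes
       only the one at [n]. *)
    assert (E_div : forall f, value_divisible p n f -> divides E f).
    { intros f (b & Eb & c & ->).
      assert (Hi : forall k, exists l, (f (ZtoC k) * / e (ZtoC k))%C = ZtoC l).
      { intros k. destruct (Z.eq_dec k n) as [->|Hk].
        - exists c. rewrite Eb, ZtoC_mult, e_n. field.
          rewrite <- e_n. apply e_nz.
        - destruct (IVE_int f k) as [l El]. exists l. rewrite El, e_m by exact Hk.
          field. }
      exists (mkIVE _ (entire_mult f _ (IVE_entire f) (entire_inv e He e_nz)) Hi).
      apply IVE_ext. intros z. change (f z = e z * (f z * / e z))%C. field. apply e_nz. }
    destruct (E_div q) as [v Ev]; [now exists m|].
    assert (E_P : forall f, P f -> exists h, f = mult E h).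
    { intros f Pf. destruct (Hdiv f Pf) as [h ->]. exists (mult v h).
      rewrite Ev. symmetry. apply mult_assoc. }
    assert (E_val : forall h : IVE, value_divisible p n (mult E h)).
    { intros h. destruct (IVE_int h n) as [b Eb]. exists (p * b)%Z. split.
      - change (e (ZtoC n) * h (ZtoC n) = ZtoC (p * b))%C.
        now rewrite e_n, Eb, ZtoC_mult.
      - apply Z.divide_factor_l. }
    destruct P_prime as ((P0 & Padd & Pmul) & P1 & Ppr).
    assert (PE : P E).
    { (* Dividing a member by [E] lowers its value at [n], if that is nonzero, in
         absolute value and, unless [E] is in [P], gives a member again. *)
      assert (Ind : forall N f b, P f -> f (ZtoC n) = ZtoC b -> b <> 0%Z ->
                (Z.abs b < Z.of_nat N)%Z -> P E).
      { induction N as [|N IH]; intros f b Pf Eb Hb HN; [lia|].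
        destruct (E_P f Pf) as [h ->].
        destruct (Ppr E h Pf) as [H|Ph]; [exact H|].
        destruct (IVE_int h n) as [c Ec].
        change (e (ZtoC n) * h (ZtoC n) = ZtoC b)%C in Eb.
        rewrite e_n, Ec, <- ZtoC_mult in Eb. apply ZtoC_inj in Eb.
        subst b. rewrite Z.abs_mul in HN.
        apply (IH h c Ph Ec); [intros ->; lia|]. nia. }
      destruct (Hnz (ZtoC n)) as (f & Pf & Hf).
      destruct (IVE_int f n) as [b Eb].
      apply (Ind (S (Z.abs_nat b)) f b Pf Eb); [|lia].
      intros ->. now apply Hf. }
    exists n, p. split; [exact Hp|]. intros f. split.
    + intros Pf. destruct (E_P f Pf) as [h ->]. apply E_val.
    + intros Hf. destruct (E_div f Hf) as [h ->].
      rewrite IVE_mult_comm. now apply Pmul.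
Qed.
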